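(* Let $\rho_{AB}\in\mathcal S(AB)$ with $V(A:B)_\rho\ne0$, let $r\in\mathbb R$, and put $R_n:=I(A:B)_\rho+r/\sqrt n$. Then $$\lim_{n\to\infty}\hat\alpha_{n,\rho}(e^{-nR_n})=\Phi\Big(\frac{r}{\sqrt{V(A:B)_\rho}}\Big),$$ where $\Phi(x)=\frac1{\sqrt{2\pi}}\int_{-\infty}^xe^{-t^2/2}dt$ is the standard normal cumulative distribution function. The same holds with $\hat\alpha_{n,\rho}$ replaced by $\hat\alpha^{\mathrm{iid}}_{n,\rho}$.
   Context: All Hilbert spaces are finite-dimensional, $\log$ is natural, $\mathcal S(A)$ is the set of density operators on $A$. $I(A:B)_\rho=H(A)_\rho+H(B)_\rho-H(AB)_\rho$; $V(A:B)_\rho=\operatorname{tr}[\rho_{AB}(\log\rho_{AB}-\log(\rho_A\otimes\rho_B)-I(A:B)_\rho)^2]$. $\mathcal S_{\mathrm{sym}}(A^{\otimes n})$: permutation-invariant states. $\hat\alpha_{n,\rho}(\mu)=\min\{\operatorname{tr}[\rho_{AB}^{\otimes n}(1-T)]:0\le T\le1,\ \max_{\sigma_{A^n}\in\mathcal S_{\mathrm{sym}}(A^{\otimes n}),\tau_{B^n}\in\mathcal S_{\mathrm{sym}}(B^{\otimes n})}\operatorname{tr}[(\sigma_{A^n}\otimes\tau_{B^n})T]\le\mu\}$; $\hat\alpha^{\mathrm{iid}}_{n,\rho}(\mu)=\min\{\operatorname{tr}[\rho_{AB}^{\otimes n}(1-T)]:0\le T\le1,\ \max_{\sigma_A\in\mathcal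 S(A),\tau_B\in\mathcal S(B)}\operatorname{tr}[(\sigma_A^{\otimes n}\otimes\tau_B^{\otimes n})T]\le\mu\}$. *)

(* Defs.v *)
From HB Require Import structures.
From mathcomp Require Import all_boot all_order all_fingroup all_algebra.
From mathcomp Require Import all_classical all_reals all_analysis.
From mathcomp.real_closed Require Import complex.
Set Implicit Arguments. Unset Strict Implicit. Unset Printing Implicit Defensive.
Import Order.TTheory GRing.Theory Num.Theory.
Import numFieldNormedType.Exports.
Local Open Scope classical_set_scope.
Local Open Scope ring_scope.

(* Finite-dimensional quantum systems: an operator on a system whose
   computational basis is indexed by the finite type T is a T x T complex
   matrix, represented as a function T -> T -> R[i].  Composite systems are
   indexed by products of finite types, n-fold tensor powers by
   {ffun 'I_n -> T}. *)
Definition op (R : realType) (T : finType) := T -> T -> R[i].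

Section Ops.
Variable R : realType.
Local Notation C := R[i].
Local Notation "x %:C" := (real_complex R x) : ring_scope.

Definition cconj (z : C) : C := conjc z.

Definition opmul (T : finType) (A B : op R T) : op R T :=
  fun x y => \sum_(z : T) A x z * B z y.
Definition opadd (T : finType) (A B : op R T) : op R T := fun x y => A x y + B x y.
Definition opopp (T : finType) (A : op R T) : op R T := fun x y => - A x y.
Definition opscale (T : finType) (c : C) (A : op R T) : op R T := fun x y => c * A x y.
Definition opone (T : finType) : op R T := fun x y => (x == y)%:R.
Arguments opone T : clear implicits.
Definition optr (T : finType) (A : op R T) : C := \sum_(x : T) A x x.
Definition retr (T : finType) (A : op R T) : R := complex.Re (optr A).

Definition hermitian (T : finType) (A : op R T) : Prop :=
  forall x y, A y x = cconj (A x y).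
Definition psd (T : finType) (A : op R T) : Prop :=
  hermitian A /\
  forall v : T -> C, 0 <= \sum_(x : T) \sum_(y : T) cconj (v x) * A x y * v y.
Definition density (T : finType) (A : op R T) : Prop := psd A /\ optr A = 1.
Definition test_op (T : finType) (M : op R T) : Prop :=
  psd M /\ psd (opadd (opone _) (opopp M)).

Definition optens (T1 T2 : finType) (A : op R T1) (B : op R T2) : op R (T1 * T2)%type :=
  fun x y => A x.1 y.1 * B x.2 y.2.
Definition optpow (T : finType) (n : nat) (A : op R T) : op R {ffun 'I_n -> T} :=
  fun x y => \prod_(i < n) A (x i) (y i).
Arguments optpow {T} n A.

Definition ptrB (TA TB : finType) (rho : op R (TA * TB)%type) : op R TA :=
  fun a a' => \sum_(b : TB) rho (a, b) (a', b).
Definition ptrA (TA TB : finType) (rho : op R (TA * TB)%type) : op R TB :=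
  fun b b' => \sum_(a : TA) rho (a, b) (a, b').

(* Spectral calculus for Hermitian operators: A = sum_k lam_k |v_k><v_k|
   with (v_k)_k an orthonormal basis (indexed by T itself);
   f(A) := sum_k f(lam_k) |v_k><v_k|. *)
Definition orthonormal (T : finType) (v : T -> T -> C) : Prop :=
  forall k l, \sum_(x : T) cconj (v k x) * v l x = (k == l)%:R.
Definition spec_decomp (T : finType) (A : op R T)
    (lv : (T -> R) * (T -> T -> C)) : Prop :=
  orthonormal lv.2 /\
  forall x y, A x y = \sum_(k : T) (lv.1 k)%:C * lv.2 k x * cconj (lv.2 k y).
Definition opfun (T : finType) (f : R -> R) (A : op R T) : op R T :=
  match pselect (exists lv, spec_decomp A lv) with
  | left h => let lv := proj1_sig (cid h) in
      fun x y => \sum_(k : T) (f (lv.1 k))%:C * lv.2 k x * cconj (lv.2 k y)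
  | right _ => fun _ _ => 0
  end.

(* natural logarithm with the convention log 0 := 0 (log on the support) *)
Definition logc (x : R) : R := if 0 < x then ln x else 0.
Definition oplog (T : finType) (A : op R T) : op R T := opfun logc A.

Definition entropy (T : finType) (rho : op R T) : R := - retr (opmul rho (oplog rho)).

Definition mutinf (TA TB : finType) (rho : op R (TA * TB)%type) : R :=
  entropy (ptrB rho) + entropy (ptrA rho) - entropy rho.

Definition mutinf_var (TA TB : finType) (rho : op R (TA * TB)%type) : R :=
  let K := opadd (opadd (oplog rho) (opopp (oplog (optens (ptrB rho) (ptrA rho)))))
                 (opopp (opscale (mutinf rho)%:C (opone _))) in
  retr (opmul rho (opmul K K)).

Definition perm_inv (T : finType) (n : nat) (A : op R {ffun 'I_n -> T}) : Prop :=
  forall (s : 'S_n) (x y : {ffun 'I_n -> T}),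
    A [ffun i => x (s i)] [ffun i => y (s i)] = A x y.
Definition sym_state (T : finType) (n : nat) (A : op R {ffun 'I_n -> T}) : Prop :=
  density A /\ perm_inv A.

(* sigma_{A^n} (x) tau_{B^n}, viewed as an operator on (AB)^{(x) n} *)
Definition tens_n (TA TB : finType) (n : nat) (s : op R {ffun 'I_n -> TA})
    (t : op R {ffun 'I_n -> TB}) : op R {ffun 'I_n -> (TA * TB)%type} :=
  fun x y => s [ffun i => (x i).1] [ffun i => (y i).1]
           * t [ffun i => (x i).2] [ffun i => (y i).2].

(* hat alpha_{n,rho}(mu): min over tests 0 <= T <= 1 of tr[rho^{(x) n}(1-T)]
   subject to max over permutation-invariant states sigma, tau of
   tr[(sigma (x) tau) T] <= mu.  The max <= mu is unfolded to "for all";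
   the min is taken as an infimum (it is attained). *)
Definition alpha_hat (TA TB : finType) (n : nat) (rho : op R (TA * TB)%type) (mu : R) : R :=
  inf [set a : R | exists M : op R {ffun 'I_n -> (TA * TB)%type},
         [/\ test_op M,
             forall s t, sym_state s -> sym_state t -> retr (opmul (tens_n s t) M) <= mu
           & a = retr (opmul (optpow n rho) (opadd (opone _) (opopp M)))]].

Definition alpha_hat_iid (TA TB : finType) (n : nat) (rho : op R (TA * TB)%type) (mu : R) : R :=
  inf [set a : R | exists M : op R {ffun 'I_n -> (TA * TB)%type},
         [/\ test_op M,
             forall (s : op R TA) (t : op R TB), density s -> density t ->
               retr (opmul (tens_n (optpow n s) (optpow n t)) M) <= mu
           & a = retr (opmul (optpow n rho) (opadd (opone _) (opopp M)))]].

Arguments alpha_hat {TA TB} n rho mu.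
Arguments alpha_hat_iid {TA TB} n rho mu.

Definition Phi (x : R) : R :=
  fine (\int[@lebesgue_measure R]_(t in `]-oo, x]) (expR (- t ^+ 2 / 2))%:E)%E
  / Num.sqrt (2 * pi).

End Ops.

(* Main.v *)
(** For an eigenbasis (l_i, v_i) of rho_AB and a product eigenbasis (m_j, u_j) of
    rho_A (x) rho_B, the Nussbaum-Szkola distribution P(i, j) = l_i |<u_j|v_i>|^2
    turns log l_i - log m_j into a random variable with mean I(A:B) and variance
    V(A:B); it is multiplicative under tensor powers, so the central limit theorem
    (proved by Stein's method) governs P^n(sum of log-ratios <= n I + y sqrt n).

    Converse: already against (rho_A (x) rho_B)^n, every test T satisfies, by
    expanding tr rho (1 - T)^2 and tr sigma T^2 in the two bases,
      (1 + d) (tr rho (1 - T) + c tr sigma T) >= P(l_i <= d c m_j),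
    without the factor 1/2 of the usual Nussbaum-Szkola bound.

    Achievability: the positive part of (pinched rho^n) - c sigma^n is a test whose
    first-kind error is at most P(l_i <= K c m_j) + poly(n) / K.  A permutation-invariant
    state on A^n is dominated by an explicit universal operator of polynomial trace
    commuting with rho_A^n; hence on a projector that almost fixes rho_A^n, all
    permutation-invariant states are at most t rho_A^n, with t = e^(d sqrt n).
    Compressing the test by such projectors on A^n and B^n costs only a factor
    e^(2 d sqrt n) in the second-kind error, and d -> 0 at the end. *)

(* The universal operator is not a tensor power, so log-ratios against it would not be sums of
   independent variables; this is why the test is built against (rho_A (x) rho_B)^n and compressed
   only afterwards.

   All losses are measured by eta = e^(-d sqrt n). A factor 1/eta in a threshold moves n I + r sqrt
   n by d sqrt n, which on the scale of the central limit theorem is a shift of r by d, and eta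
   still beats every polynomial. The converse loses two such factors. Achievability loses three: one
   for pinching, and one for each of the dominations on A^n and B^n.

   The iid constraint is the weaker of the two, so the converse is proved under it and achievability
   under the permutation-invariant one; one interval then contains both error probabilities.

   The central limit theorem is obtained in the form that Phi of the normalised sum becomes uniform
   on (0, 1). In the variable u = Phi w, a Stein solution is an antiderivative times an explicit
   factor, so piecewise linear test functions of u need no Gaussian integrals. *)
Require Import Defs.
From HB Require Import structures.
From mathcomp Require Import all_boot all_order all_fingroup all_algebra.
From mathcomp Require Import all_classical all_reals all_analysis.
From mathcomp.real_closed Require Import complex.
From mathcomp Require Import ring lra.
Set Implicit Arguments. Unset Strict Implicit. Unset Printing Implicit Defensive.
Import Order.TTheory GRing.Theory Num.Theory.
Import numFieldNormedType.Exports.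
(* sesquilinear.v also exports a notation hermitian: Defs must take precedence. *)
Import Defs.
Local Open Scope classical_set_scope.
Local Open Scope ring_scope.

(** * Operators, quadratic forms and spectral decompositions *)

Section Operators.
Variable R : realType.
Local Notation C := R[i].
Local Notation "x %:C" := (real_complex R x) : ring_scope.
Local Notation Re := (@complex.Re R).
Local Notation Im := (@complex.Im R).

Lemma Re_add (x y : C) : Re (x + y) = Re x + Re y.
Proof. by case: x y => [a b] [c d]. Qed.

Lemma Re_opp (x : C) : Re (- x) = - Re x.
Proof. by case: x. Qed.

Lemma Re_sum (I : Type) (r : seq I) (P : pred I) (F : I -> C) :
  Re (\sum_(i <- r | P i) F i) = \sum_(i <- r | P i) Re (F i).
Proof. exact: (big_morph Re Re_add). Qed.

Lemma Re_scale (a : R) (x : C) : Re (a%:C * x) = a * Re x.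
Proof. by case: x => c d /=; rewrite mul0r subr0. Qed.

Lemma Re_conj (x : C) : Re (conjc x) = Re x.
Proof. by case: x. Qed.

Lemma conjc_realC (x : R) : conjc x%:C = x%:C.
Proof. by apply/eqP; rewrite eq_complex /= oppr0 !eqxx. Qed.

Lemma conjcM (x y : C) : conjc (x * y) = conjc x * conjc y.
Proof. exact: rmorphM. Qed.

Lemma realC_sum (I : Type) (r : seq I) (P : pred I) (F : I -> R) :
  (\sum_(i <- r | P i) F i)%:C = \sum_(i <- r | P i) (F i)%:C.
Proof. exact: rmorph_sum. Qed.

Lemma conjc_sum (I : Type) (r : seq I) (P : pred I) (F : I -> C) :
  conjc (\sum_(i <- r | P i) F i) = \sum_(i <- r | P i) conjc (F i).
Proof. exact: rmorph_sum. Qed.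

Definition nsq (z : C) : R := Re z ^+ 2 + Im z ^+ 2.

Lemma nsqE (z : C) : conjc z * z = (nsq z)%:C.
Proof.
by case: z => a b; apply/eqP; rewrite eq_complex /nsq /=; apply/andP; split; apply/eqP; ring.
Qed.

Lemma nsq_ge0 z : 0 <= nsq z.
Proof. by rewrite addr_ge0 ?sqr_ge0. Qed.

Lemma nsq_conj z : nsq (conjc z) = nsq z.
Proof. by case: z => a b; rewrite /nsq /= sqrrN. Qed.

Lemma nsqM z w : nsq (z * w) = nsq z * nsq w.
Proof. by case: z w => [a b] [c d]; rewrite /nsq /=; ring. Qed.

Lemma nsq_real (a : R) : nsq a%:C = a ^+ 2.
Proof. by rewrite /nsq /= expr0n addr0. Qed.

Lemma nsq0 : nsq 0 = 0.
Proof. by rewrite /nsq /= expr0n addr0. Qed.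

Lemma nsq1 : nsq 1 = 1.
Proof. by rewrite /nsq /= expr0n addr0 expr1n. Qed.

Lemma nsq_prod (I : finType) (F : I -> C) :
  nsq (\prod_i F i) = \prod_i nsq (F i).
Proof. exact: (big_morph nsq nsqM nsq1). Qed.

(** The difference of the two sides is |d z - w|^2 / d. A small weight [d] keeps the leading
    constant near 1, whereas [d = 1] would give the factor 2. *)
Lemma nsq_add_le (d : R) (z w : C) : 0 < d ->
  nsq (z + w) <= (1 + d) * (nsq z + nsq w / d).
Proof.
move=> d0; rewrite -subr_ge0.
have -> : (1 + d) * (nsq z + nsq w / d) - nsq (z + w) =
   ((d * Re z - Re w) ^+ 2 + (d * Im z - Im w) ^+ 2) / d.
  by case: z w => [a b] [c e]; rewrite /nsq /=; field; rewrite gt_eqF.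
by rewrite divr_ge0 ?(ltW d0) ?addr_ge0 ?sqr_ge0.
Qed.

Section OneSystem.
Variable T : finType.
Implicit Types (v w z : T -> C) (A B X M : op R T).

Definition ip v w : C := \sum_x conjc (v x) * w x.
Definition app A v : T -> C := fun x => \sum_y A x y * v y.
Definition adj A : op R T := fun x y => conjc (A y x).
Definition nrm v : R := \sum_x nsq (v x).
(** Taking the real part makes the form R-valued for every [A]; for Hermitian [A] it loses nothing
    ([qf_real]), so operator inequalities become real inequalities. *)
Definition qf A v : R := Re (ip v (app A v)).
Definition spop (f : T -> R) (v : T -> T -> C) : op R T :=
  fun x y => \sum_k (f k)%:C * v k x * conjc (v k y).
Definition commuting A B := forall v, app A (app B v) = app B (app A v).

Lemma ip_conj v w : conjc (ip v w) = ip w v.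
Proof. by rewrite /ip conjc_sum; apply: eq_bigr => x _; rewrite rmorphM /= conjcK mulrC. Qed.

Lemma ip_sumr (I : Type) (r : seq I) (P : pred I) (F : I -> T -> C) v :
  ip v (fun x => \sum_(i <- r | P i) F i x) = \sum_(i <- r | P i) ip v (F i).
Proof. by rewrite /ip exchange_big; apply: eq_bigr => x _; rewrite mulr_sumr. Qed.

Lemma ip_scaler (c : C) v w : ip v (fun x => c * w x) = c * ip v w.
Proof. by rewrite /ip mulr_sumr; apply: eq_bigr => x _; rewrite mulrCA. Qed.

Lemma ip_addr v w z : ip v (w \+ z) = ip v w + ip v z.
Proof. by rewrite /ip -big_split; apply: eq_bigr => x _; rewrite mulrDr. Qed.

Lemma ip_subr v w z : ip v (w \- z) = ip v w - ip v z.
Proof. by rewrite /ip -sumrB; apply: eq_bigr => x _; rewrite mulrBr. Qed.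

Lemma ip_subl v w z : ip (w \- z) v = ip w v - ip z v.
Proof. by rewrite -ip_conj ip_subr rmorphB /= !ip_conj. Qed.

Lemma ip_addl v w z : ip (w \+ z) v = ip w v + ip z v.
Proof. by rewrite -ip_conj ip_addr rmorphD /= !ip_conj. Qed.

Lemma ipvv v : ip v v = (nrm v)%:C.
Proof. by rewrite /ip /nrm realC_sum; apply: eq_bigr => x _; rewrite nsqE. Qed.

Lemma nrmE v : nrm v = Re (ip v v). Proof. by rewrite ipvv. Qed.

Lemma nrm_ge0 v : 0 <= nrm v.
Proof. by apply: sumr_ge0 => x _; apply: nsq_ge0. Qed.

Lemma ip_app v A w : ip v (app A w) = ip (app (adj A) v) w.
Proof.
rewrite /ip /app; under eq_bigr do rewrite mulr_sumr.
rewrite exchange_big; apply: eq_bigr => y _ /=.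
rewrite conjc_sum mulr_suml; apply: eq_bigr => x _.
by rewrite rmorphM /= conjcK mulrCA mulrA.
Qed.

Lemma hermitian_adj A : hermitian A -> adj A = A.
Proof.
by move=> h; apply/funext => x; apply/funext => y; rewrite /adj h /cconj conjcK.
Qed.

Lemma ip_appC v A w : hermitian A -> ip v (app A w) = ip (app A v) w.
Proof. by move=> h; rewrite ip_app hermitian_adj. Qed.

Lemma app_mul A B v : app (opmul A B) v = app A (app B v).
Proof.
apply/funext => x; rewrite /app /opmul.
under eq_bigr do rewrite mulr_suml.
under [RHS]eq_bigr do rewrite mulr_sumr.
by rewrite exchange_big; do 2!apply: eq_bigr => ? _; rewrite mulrA.
Qed.

Lemma app_sumr (I : Type) (r : seq I) (P : pred I) (F : I -> T -> C) A :
  app A (fun x => \sum_(i <- r | P i) F i x) =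
  fun x => \sum_(i <- r | P i) app A (F i) x.
Proof.
apply/funext => x; rewrite /app exchange_big.
by apply: eq_bigr => y _; rewrite mulr_sumr.
Qed.

Lemma app_scaler (c : C) A v : app A (fun x => c * v x) = fun x => c * app A v x.
Proof.
by apply/funext => x; rewrite /app mulr_sumr; apply: eq_bigr => y _; rewrite mulrCA.
Qed.

Lemma app_subr A v w : app A (v \- w) = app A v \- app A w.
Proof. by apply/funext => x; rewrite /app /= -sumrB; apply: eq_bigr => y _; rewrite mulrBr. Qed.

Lemma app_addr A v w : app A (v \+ w) = app A v \+ app A w.
Proof. by apply/funext => x; rewrite /app /= -big_split /=; apply: eq_bigr => y _; rewrite mulrDr. Qed.

Lemma app_add A B v : app (opadd A B) v = app A v \+ app B v.
Proof. by apply/funext => x; rewrite /app /opadd /= -big_split /=; apply: eq_bigr => y _; rewrite mulrDl. Qed.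

Lemma app_opp A v : app (opopp A) v = \- app A v.
Proof. by apply/funext => x; rewrite /app /opopp /= -sumrN; apply: eq_bigr => y _; rewrite mulNr. Qed.

Lemma app_scale c A v : app (opscale c A) v = fun x => c * app A v x.
Proof. by apply/funext => x; rewrite /app /opscale mulr_sumr; apply: eq_bigr => y _; rewrite mulrA. Qed.

Lemma app_one v : app (@opone R T) v = v.
Proof.
apply/funext => x; rewrite /app /opone (bigD1 x) //= eqxx mul1r big1 ?addr0 //.
by move=> y; rewrite eq_sym => /negbTE ->; rewrite mul0r.
Qed.

Lemma app_inj A B : (forall v, app A v = app B v) -> A = B.
Proof.
move=> h; apply/funext => x; apply/funext => y.
have := congr1 (@^~ x) (h (fun z : T => (z == y)%:R)); rewrite /= /app.
rewrite (bigD1 y) //= eqxx mulr1 big1 => [|z /negbTE ->]; last by rewrite mulr0.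
rewrite addr0 (bigD1 y) //= eqxx mulr1 big1 => [|z /negbTE ->]; last by rewrite mulr0.
by rewrite addr0.
Qed.

Lemma qf_add A B v : qf (opadd A B) v = qf A v + qf B v.
Proof. by rewrite /qf app_add ip_addr Re_add. Qed.

Lemma qf_opp A v : qf (opopp A) v = - qf A v.
Proof.
rewrite /qf app_opp -Re_opp; congr (Re _).
by rewrite /ip -sumrN; apply: eq_bigr => x _; rewrite mulrN.
Qed.

Lemma qf_scale (c : R) A v : qf (opscale c%:C A) v = c * qf A v.
Proof. by rewrite /qf app_scale ip_scaler Re_scale. Qed.

Lemma qf_one v : qf (@opone R T) v = nrm v.
Proof. by rewrite /qf app_one nrmE. Qed.

Lemma qf_sum (I : Type) (r : seq I) (P : pred I) (F : I -> op R T) v :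
  qf (fun x y => \sum_(i <- r | P i) F i x y) v = \sum_(i <- r | P i) qf (F i) v.
Proof.
rewrite /qf -Re_sum -ip_sumr; congr (Re (ip _ _)); apply/funext => x.
rewrite /app exchange_big; apply: eq_bigr => y _; by rewrite mulr_suml.
Qed.

Lemma qf_conj A X v : hermitian X -> qf (opmul X (opmul A X)) v = qf A (app X v).
Proof. by move=> hX; rewrite /qf !app_mul ip_appC. Qed.

Lemma qfE A v : \sum_x \sum_y cconj (v x) * A x y * v y = ip v (app A v).
Proof.
rewrite /ip; apply: eq_bigr => x _; rewrite /app mulr_sumr.
by apply: eq_bigr => y _; rewrite mulrA.
Qed.

Lemma qf_real A v : hermitian A -> ip v (app A v) = (qf A v)%:C.
Proof.
move=> hA; rewrite /qf; set z := ip _ _.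
have : conjc z = z by rewrite /z ip_conj ip_appC.
case: z => a b [] /eqP; rewrite eqNr => /eqP /= ->.
by [].
Qed.

Lemma psdP A : psd A <-> hermitian A /\ forall v, 0 <= qf A v.
Proof.
split=> -[hA pA]; split=> // v; have := pA v.
  by rewrite qfE qf_real // lecR.
by rewrite qfE qf_real // lecR.
Qed.

Lemma psd_qf A v : psd A -> 0 <= qf A v.
Proof. by move/psdP => []. Qed.

Lemma hermitian_one : hermitian (@opone R T).
Proof. by move=> x y; rewrite /opone /cconj conjc_nat eq_sym. Qed.

Lemma hermitian_add A B : hermitian A -> hermitian B -> hermitian (opadd A B).
Proof. by move=> hA hB x y; rewrite /opadd hA hB /cconj rmorphD. Qed.

Lemma hermitian_opp A : hermitian A -> hermitian (opopp A).
Proof. by move=> hA x y; rewrite /opopp hA /cconj rmorphN. Qed.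

Lemma hermitian_scale (c : R) A : hermitian A -> hermitian (opscale c%:C A).
Proof. by move=> hA x y; rewrite /opscale hA /cconj conjcM conjc_realC. Qed.

Lemma hermitian_sum (I : Type) (r : seq I) (P : pred I) (F : I -> op R T) :
  (forall i, hermitian (F i)) ->
  hermitian (fun x y => \sum_(i <- r | P i) F i x y).
Proof.
by move=> h x y; rewrite /cconj conjc_sum; apply: eq_bigr => i _; rewrite h.
Qed.

Lemma hermitian_conj A X : hermitian A -> hermitian X ->
  hermitian (opmul X (opmul A X)).
Proof.
move=> hA hX x y; rewrite /opmul /cconj conjc_sum.
under eq_bigr do rewrite mulr_sumr.
rewrite exchange_big; apply: eq_bigr => a _ /=.
rewrite conjcM conjc_sum mulr_sumr; apply: eq_bigr => b _ /=.
by rewrite (hX b y) (hA a b) (hX x a) conjcM /cconj; ring.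
Qed.

Lemma hermitian_spop f (v : T -> T -> C) : hermitian (spop f v).
Proof.
move=> x y; rewrite /spop /cconj conjc_sum; apply: eq_bigr => k _.
by rewrite !conjcM conjcK conjc_realC; ring.
Qed.

Lemma opadd_opp_one M v : qf (opadd (@opone R T) (opopp M)) v = nrm v - qf M v.
Proof. by rewrite qf_add qf_opp qf_one. Qed.

Lemma test_opP M : test_op M <->
  hermitian M /\ forall v, 0 <= qf M v <= nrm v.
Proof.
split.
  move=> [/psdP [hM pM] /psdP [_ p]]; split=> // v; rewrite pM /=.
  by have := p v; rewrite opadd_opp_one subr_ge0.
move=> [hM b]; split; apply/psdP; split=> //.
- by move=> v; case/andP: (b v).
- by apply: hermitian_add (hermitian_opp hM); exact: hermitian_one.
- by move=> v; rewrite opadd_opp_one subr_ge0; case/andP: (b v).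
Qed.

Lemma app_spop f (v : T -> T -> C) w : app (spop f v) w = fun x => \sum_k (f k)%:C * ip (v k) w * v k x.
Proof.
apply/funext => x; rewrite /app /spop.
under eq_bigr do rewrite mulr_suml.
rewrite exchange_big; apply: eq_bigr => k _.
rewrite /ip mulr_sumr mulr_suml; apply: eq_bigr => y _; ring.
Qed.

Lemma ip_spop f (v : T -> T -> C) w z :
  ip z (app (spop f v) w) = \sum_k (f k)%:C * (conjc (ip (v k) z) * ip (v k) w).
Proof.
rewrite app_spop ip_sumr; apply: eq_bigr => k _.
by rewrite ip_scaler ip_conj mulrAC mulrA.
Qed.

Lemma qf_spop f (v : T -> T -> C) w : qf (spop f v) w = \sum_k f k * nsq (ip (v k) w).
Proof.
rewrite /qf ip_spop Re_sum; apply: eq_bigr => k _.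
by rewrite Re_scale nsqE.
Qed.

Lemma psd_spop f (v : T -> T -> C) : (forall k, 0 <= f k) -> psd (spop f v).
Proof.
move=> f0; apply/psdP; split=> [|w]; first exact: hermitian_spop.
by rewrite qf_spop; apply: sumr_ge0 => k _; rewrite mulr_ge0 ?nsq_ge0.
Qed.

(** Unlike in [spop], the index set is arbitrary and the vectors need not be orthonormal, which
    suits partial traces and product operators. *)
Definition ketbras (I : finType) (c : I -> R) (v : I -> T -> C) : op R T :=
  fun x y => \sum_k (c k)%:C * v k x * conjc (v k y).

Lemma psd_ketbras (I : finType) (c : I -> R) (v : I -> T -> C) :
  (forall k, 0 <= c k) -> psd (ketbras c v).
Proof.
move=> c0; apply/psdP; split=> [x y|w].
  rewrite /ketbras /cconj conjc_sum; apply: eq_bigr => k _.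
  by rewrite !conjcM conjcK conjc_realC; ring.
suff -> : qf (ketbras c v) w = \sum_k c k * nsq (ip (v k) w).
  by apply: sumr_ge0 => k _; rewrite mulr_ge0 ?nsq_ge0.
rewrite /ketbras qf_sum; apply: eq_bigr => k _.
transitivity (Re ((c k)%:C * (conjc (ip (v k) w) * ip (v k) w))); last first.
  by rewrite nsqE Re_scale.
rewrite ip_conj /qf; congr (Re _).
rewrite /ip /app mulr_suml mulr_sumr; apply: eq_bigr => x _.
rewrite !mulr_sumr; apply: eq_bigr => y _; ring.
Qed.

Lemma retr_ketbras_mul (I : finType) (f : I -> R) (v : I -> T -> C) M :
  retr (opmul (ketbras f v) M) = \sum_k f k * qf M (v k).
Proof.
rewrite /retr /optr /opmul /ketbras.
under eq_bigr do under eq_bigr do rewrite mulr_suml.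
under eq_bigr do rewrite exchange_big.
rewrite exchange_big Re_sum; apply: eq_bigr => k _.
rewrite -Re_scale; congr (Re _); rewrite /ip mulr_sumr exchange_big /=.
apply: eq_bigr => y _; rewrite /app mulr_sumr mulr_sumr.
by apply: eq_bigr => x _; ring.
Qed.

Lemma retr_spop_mul f (v : T -> T -> C) M : retr (opmul (spop f v) M) = \sum_k f k * qf M (v k).
Proof. exact: retr_ketbras_mul. Qed.

Lemma optr_mulC A B : optr (opmul A B) = optr (opmul B A).
Proof.
rewrite /optr /opmul exchange_big; apply: eq_bigr => x _.
by apply: eq_bigr => y _; rewrite mulrC.
Qed.

Lemma retr_mulC A B : retr (opmul A B) = retr (opmul B A).
Proof. by rewrite /retr optr_mulC. Qed.

Lemma retr_mul_spop f (v : T -> T -> C) M : retr (opmul M (spop f v)) = \sum_k f k * qf M (v k).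
Proof. by rewrite retr_mulC retr_spop_mul. Qed.

Lemma opmulA A B M : opmul A (opmul B M) = opmul (opmul A B) M.
Proof. by apply: app_inj => v; rewrite !app_mul. Qed.

Lemma opmul1 A : opmul A (@opone R T) = A.
Proof. by apply: app_inj => v; rewrite app_mul app_one. Qed.

Lemma op1mul A : opmul (@opone R T) A = A.
Proof. by apply: app_inj => v; rewrite app_mul app_one. Qed.

Lemma retr_one_sub A M : retr (opmul A (opadd (@opone R T) (opopp M))) =
  retr A - retr (opmul A M).
Proof.
rewrite /retr -Re_opp -Re_add; congr (Re _); rewrite /optr -sumrB.
apply: eq_bigr => x _; rewrite -[A in LHS]opmul1 {1}opmul1 /opmul -[A x x]/(A x x).
rewrite -{2}[A]opmul1 /opmul -sumrB; apply: eq_bigr => y _.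
by rewrite /opadd /opopp mulrBr.
Qed.

(** * Orthonormal bases and functions of operators diagonal in them *)

Section Orthonormal.
Variable v : T -> T -> C.
Hypothesis ov : orthonormal v.

Lemma ip_orth k l : ip (v k) (v l) = (k == l)%:R.
Proof. exact: ov. Qed.

(** Orthonormality says that a square matrix has a left inverse, completeness that the same matrix
    is a right inverse. *)
Lemma basis_complete x y : \sum_k v k x * conjc (v k y) = (x == y)%:R.
Proof.
pose V : 'M[C]_#|T| := \matrix_(i, j) conjc (v (enum_val i) (enum_val j)).
pose W : 'M[C]_#|T| := \matrix_(i, j) v (enum_val j) (enum_val i).
have VW : V *m W = 1%:M.
  apply/matrixP => i j; rewrite !mxE.
  rewrite -(inj_eq enum_val_inj) -ov.
  rewrite (reindex (@enum_val T T)) /=; last by apply: onW_bij; exact: enum_val_bij.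
  by apply: eq_bigr => k _; rewrite !mxE.
have /matrixP /(_ (enum_rank x) (enum_rank y)) := mulmx1C VW.
rewrite !mxE (inj_eq enum_rank_inj) => <-.
rewrite (reindex (@enum_val T T)) /=; last by apply: onW_bij; exact: enum_val_bij.
by apply: eq_bigr => k _; rewrite !mxE !enum_rankK.
Qed.

Lemma spop1 : spop (fun=> 1) v = @opone R T.
Proof.
apply/funext => x; apply/funext => y; rewrite /opone -basis_complete.
by apply: eq_bigr => k _; rewrite mul1r.
Qed.

Lemma basis_expand w : w = fun x => \sum_k ip (v k) w * v k x.
Proof.
rewrite -{1}[w]app_one -spop1 app_spop; apply/funext => x.
by apply: eq_bigr => k _; rewrite mul1r.
Qed.

Lemma basis_ext w z : (forall k, ip (v k) w = ip (v k) z) -> w = z.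
Proof.
move=> h; rewrite [w]basis_expand [RHS]basis_expand; apply/funext => x.
by apply: eq_bigr => k _; rewrite h.
Qed.

Lemma ip_parseval w z : ip w z = \sum_k conjc (ip (v k) w) * ip (v k) z.
Proof.
rewrite -{1}[z]app_one -spop1 ip_spop.
by apply: eq_bigr => k _; rewrite mul1r.
Qed.

Lemma parseval w : nrm w = \sum_k nsq (ip (v k) w).
Proof.
rewrite nrmE ip_parseval Re_sum.
by apply: eq_bigr => k _; rewrite nsqE.
Qed.

Lemma nrm_basis k : nrm (v k) = 1.
Proof. by rewrite nrmE ip_orth eqxx. Qed.

Lemma ip_basis_spop f k w : ip (v k) (app (spop f v) w) = (f k)%:C * ip (v k) w.
Proof.
rewrite ip_spop (bigD1 k) //= ip_orth eqxx conjc1 mul1r big1 ?addr0 //.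
by move=> l /negbTE lk; rewrite ip_orth lk conjc0 mul0r mulr0.
Qed.

Lemma app_spop_basis f k : app (spop f v) (v k) = fun x => (f k)%:C * v k x.
Proof.
apply: basis_ext => l; rewrite ip_basis_spop ip_scaler ip_orth.
by case: eqP => [->|] //; rewrite !mulr0.
Qed.

Lemma app_spop_spop f g w :
  app (spop f v) (app (spop g v) w) = app (spop (fun k => f k * g k) v) w.
Proof.
by apply: basis_ext => k; rewrite !ip_basis_spop mulrA rmorphM.
Qed.

Lemma optr_basis A : optr A = \sum_k ip (v k) (app A (v k)).
Proof.
transitivity (optr (opmul (spop (fun=> 1) v) A)); first by rewrite spop1 op1mul.
rewrite /optr /opmul /spop.
under eq_bigr do under eq_bigr do rewrite mulr_suml.
under eq_bigr do rewrite exchange_big.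
rewrite exchange_big; apply: eq_bigr => k _.
rewrite /ip exchange_big /=.
apply: eq_bigr => y _; rewrite /app mulr_sumr.
by apply: eq_bigr => x _; rewrite mul1r; ring.
Qed.

Lemma retr_basis A : retr A = \sum_k qf A (v k).
Proof. by rewrite /retr optr_basis Re_sum. Qed.

Lemma retr_spop f : retr (spop f v) = \sum_k f k.
Proof.
rewrite -[spop f v]opmul1 retr_spop_mul; apply: eq_bigr => k _.
by rewrite qf_one nrm_basis mulr1.
Qed.

(** In the eigenbasis, commutation reads (d l - d k) <v_k|X v_l> = 0: [X] connects equal eigenvalues
    only, hence respects every function of them. It is applied to spectral projections, and to
    permutation operators, which are in general not Hermitian. *)
Lemma commuting_spop d F X :
  commuting X (spop d v) -> commuting X (spop (F \o d) v).
Proof.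
move=> cX w; apply: basis_ext => k; rewrite ip_basis_spop.
have key l : (d l)%:C * ip (v k) (app X (v l)) = (d k)%:C * ip (v k) (app X (v l)).
  have := congr1 (ip (v k)) (cX (v l)).
  by rewrite app_spop_basis app_scaler ip_scaler ip_basis_spop.
have keyF l : (F (d l))%:C * ip (v k) (app X (v l)) =
              (F (d k))%:C * ip (v k) (app X (v l)).
  have [->//|ne] := eqVneq (d l) (d k).
  suff -> : ip (v k) (app X (v l)) = 0 by rewrite !mulr0.
  move/eqP: (key l); rewrite -subr_eq0 -mulrBl mulf_eq0 => /orP[|/eqP//].
  by rewrite -rmorphB /= fmorph_eq0 subr_eq0 (negbTE ne).
rewrite [in RHS](basis_expand w) app_spop !app_sumr !ip_sumr mulr_sumr.
apply: eq_bigr => l _; rewrite !app_scaler !ip_scaler.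
by rewrite -mulrA mulrCA keyF mulrCA.
Qed.

End Orthonormal.

Lemma spectral_exists A : hermitian A -> exists lv : (T -> R) * (T -> T -> C),
  orthonormal lv.2 /\ A = spop lv.1 lv.2.
Proof.
move=> hA.
pose M : 'M[C]_#|T| := \matrix_(i, j) A (enum_val i) (enum_val j).
have conjE (z : C) : Num.conj z = conjc z by [].
have hM : M \is hermsymmx.
  apply/is_hermitianmxP; rewrite expr0 scale1r; apply/matrixP => i j.
  by rewrite !mxE conjE hA.
have rD := hermitian_spectral_diag_real hM.
have uP := spectral_unitarymx M.
have /orthomx_spectralP := hermitian_normalmx hM.
rewrite invmx_unitary // => ME.
set P := spectralmx M in uP ME; set D := spectral_diag M in rD ME.
pose lam k := Re (D 0 (enum_rank k)).
have DE i : D 0 i = (lam (enum_val i))%:C.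
  by rewrite /lam enum_valK RRe_real //; move/mxOverP: rD; apply.
(* The matrix is the adjoint of P times D times P, so the eigenvectors are the conjugated rows of
   P. *)
pose v k x := conjc (P (enum_rank k) (enum_rank x)).
exists (lam, v); split => /=.
  move=> k l.
  have /unitarymxP/matrixP/(_ (enum_rank k) (enum_rank l)) := uP.
  rewrite !mxE (inj_eq enum_rank_inj) => <-.
  rewrite (reindex (@enum_rank T)) /=; last by apply: onW_bij; exact: enum_rank_bij.
  by apply: eq_bigr => x _; rewrite !mxE /v /cconj conjcK.
apply/funext => x; apply/funext => y.
have /matrixP/(_ (enum_rank x) (enum_rank y)) := ME.
rewrite !mxE !enum_rankK => ->.
rewrite (reindex (@enum_rank T)) /=; last by apply: onW_bij; exact: enum_rank_bij.
apply: eq_bigr => k _; rewrite !mxE (bigD1 (enum_rank k)) //= big1 => [|j /negbTE jk].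
  by rewrite !mxE eqxx mulr1n addr0 /v conjcK conjE DE enum_rankK; ring.
by rewrite !mxE jk mulr0n mulr0.
Qed.

Lemma psd_spectral A : psd A -> exists lv : (T -> R) * (T -> T -> C),
  [/\ orthonormal lv.2, A = spop lv.1 lv.2 & forall k, 0 <= lv.1 k].
Proof.
move=> /psdP [hA pA]; have [[l v] /= [ov AE]] := spectral_exists hA.
exists (l, v); split=> //= k; have := pA (v k).
rewrite AE qf_spop (bigD1 k) //= ip_orth // eqxx nsq1 mulr1 big1 ?addr0 //.
by move=> j /negbTE jk; rewrite ip_orth // jk nsq0 mulr0.
Qed.

(** Eigenvectors of the two decompositions are orthogonal unless their eigenvalues agree. This frees
    [opfun] from the arbitrary choice of a decomposition. *)
Lemma spop_unique f l m (v u : T -> T -> C) : orthonormal v -> orthonormal u ->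
  spop l v = spop m u -> spop (f \o l) v = spop (f \o m) u.
Proof.
move=> ov ou e; apply: app_inj => w; apply: (basis_ext ov) => k.
rewrite ip_basis_spop // (ip_parseval ou) [in RHS](ip_parseval ou) mulr_sumr.
apply: eq_bigr => j _; rewrite ip_basis_spop //= mulrCA; rewrite ip_conj.
have [->|ne] := eqVneq (l k) (m j); first by [].
suff -> : ip (v k) (u j) = 0 by rewrite !mul0r.
have : ip (v k) (app (spop l v) (u j)) = ip (v k) (app (spop m u) (u j)) by rewrite e.
rewrite ip_basis_spop // app_spop_basis // ip_scaler => /eqP.
rewrite -subr_eq0 -mulrBl mulf_eq0 => /orP[|/eqP//].
by rewrite -rmorphB /= fmorph_eq0 subr_eq0 (negbTE ne).
Qed.

Lemma spec_decompP A lv : spec_decomp A lv <-> orthonormal lv.2 /\ A = spop lv.1 lv.2.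
Proof.
split=> -[ol h]; split=> //; first by apply/funext => x; apply/funext => y.
by move=> x y; rewrite h.
Qed.

Lemma opfun_spop f l (v : T -> T -> C) : orthonormal v -> opfun f (spop l v) = spop (f \o l) v.
Proof.
move=> ov; rewrite /opfun; case: pselect => [h|]; last first.
  by case; exists (l, v); apply/spec_decompP.
case: (cid h) => -[m u] /= /spec_decompP /= [ou e].
by symmetry; apply: spop_unique.
Qed.

(* T - T^2 = T (1 - T) T + (1 - T) T (1 - T) *)
Lemma test_sqr_le M v : test_op M -> nrm (app M v) <= qf M v.
Proof.
move=> /test_opP [hM b]; set w := app M v.
have /andP[_ h1] := b w; have /andP[h2 _] := b (v \- w).
move: h2; rewrite /qf app_subr ip_subr !ip_subl -/w.
have -> : ip v (app M w) = ip w w by rewrite ip_appC.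
rewrite !(Re_add, Re_opp) -nrmE -/(qf M w) -/(qf M v); lra.
Qed.

Lemma test_compl M : test_op M -> test_op (opadd (@opone R T) (opopp M)).
Proof.
move/test_opP => [hM b]; apply/test_opP; split.
  by apply: hermitian_add (hermitian_opp hM); exact: hermitian_one.
by move=> v; rewrite opadd_opp_one; have /andP[] := b v; lra.
Qed.

End OneSystem.
End Operators.

(** * Binary hypothesis testing *)

Section Testing.
Variable R : realType.
Local Notation C := R[i].
Local Notation "x %:C" := (real_complex R x) : ring_scope.
Local Notation Re := (@complex.Re R).

Section OneSystem.
Variable T : finType.
Implicit Types (v w z : T -> C) (A B X M P : op R T).

Definition opcompl M : op R T := opadd (@opone R T) (opopp M).
Definition projector P := hermitian P /\ forall v, app P (app P v) = app P v.

Lemma qf_compl M v : qf (opcompl M) v = nrm v - qf M v.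
Proof. exact: opadd_opp_one. Qed.

Lemma app_compl M v : app (opcompl M) v = v \- app M v.
Proof. by rewrite /opcompl app_add app_one app_opp. Qed.

Lemma app0 A : app A (fun=> 0) = fun=> 0.
Proof. by apply/funext => x; rewrite /app big1 // => y _; rewrite mulr0. Qed.

Lemma ip_nrm_Re v w : Re (ip v w) = Re (ip w v).
Proof. by rewrite -ip_conj Re_conj. Qed.

Lemma qf_projector P v : projector P -> qf P v = nrm (app P v).
Proof. by move=> [hP idP]; rewrite nrmE -ip_appC // idP. Qed.

Lemma ip_scalel (c : C) v w : ip (fun x => c * v x) w = conjc c * ip v w.
Proof. by rewrite -ip_conj ip_scaler conjcM ip_conj. Qed.

Lemma nrm_sub_projector P v : projector P ->
  nrm (v \- app P v) = qf (opcompl P) v.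
Proof.
move=> pP; rewrite qf_compl qf_projector // !nrmE ip_subr !ip_subl.
case: pP => hP idP; rewrite [ip v (app P v)]ip_appC //.
have -> : ip (app P v) v = ip (app P v) (app P v).
  by rewrite -[RHS]ip_appC // idP ip_appC.
by rewrite subrr subr0 Re_add Re_opp.
Qed.

Lemma projector_le P v : projector P -> nrm (app P v) <= nrm v.
Proof.
move=> pP; rewrite -subr_ge0 -(qf_projector v pP) -qf_compl.
by rewrite -nrm_sub_projector // nrm_ge0.
Qed.

Lemma projector_spop f (v : T -> T -> C) : orthonormal v ->
  (forall k, f k * f k = f k) -> projector (spop f v).
Proof.
move=> ov ff; split=> [|w]; first exact: hermitian_spop.
by rewrite app_spop_spop //; congr (app (spop _ _) _); apply/funext => k; rewrite ff.
Qed.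

Lemma projector_test P : projector P -> test_op P.
Proof.
move=> pP; apply/test_opP; split=> [|v]; first exact: (proj1 pP).
by rewrite qf_projector // nrm_ge0 projector_le.
Qed.

(** Positivity of the form at h v + z, divided by h. *)
Lemma qf_sub_le A v z (h : R) : psd A -> 0 < h ->
  qf A (v \- z) <= (1 + h) * qf A v + (1 + h^-1) * qf A z.
Proof.
move=> /psdP [hA pA] h0.
have := pA ((fun x => h%:C * v x) \+ z).
rewrite /qf app_addr app_subr app_scaler.
rewrite ip_subr !ip_subl ip_addr !ip_addl !ip_scaler !ip_scalel conjc_realC.
have -> : ip z (app A v) = conjc (ip v (app A z)).
  by rewrite ip_conj ip_appC.
rewrite !(Re_add, Re_opp, Re_scale) Re_conj.
set a := Re (ip v (app A v)); set b := Re (ip v (app A z)); set e := Re (ip z (app A z)).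
move=> H; rewrite -subr_ge0.
have -> : (1 + h) * a + (1 + h^-1) * e - (a - b - (b - e)) =
   (h * (h * a + b) + (h * b + e)) / h by field; rewrite gt_eqF.
by apply: divr_ge0; [lra|exact: ltW].
Qed.

(* 1 - PMP = (1 - P) + P (1 - M) P *)
Lemma qf_compl_sandwich_le M P v (h : R) : test_op M -> projector P -> 0 < h ->
  qf (opcompl (opmul P (opmul M P))) v <=
    (1 + h) * qf (opcompl M) v + (2 + h^-1) * qf (opcompl P) v.
Proof.
move=> tM pP h0; rewrite qf_compl qf_conj; last exact: (proj1 pP).
have -> : nrm v - qf M (app P v) = qf (opcompl P) v + qf (opcompl M) (app P v).
  by rewrite !qf_compl (qf_projector v pP) addrA subrK.
have tN : test_op (opcompl M) := test_compl tM.
set z := v \- app P v.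
have -> : app P v = v \- z by apply/funext => x; rewrite /z /= opprB addrCA subrr addr0.
have pN : psd (opcompl M) := proj1 tN.
have := qf_sub_le v z pN h0.
have : qf (opcompl M) z <= qf (opcompl P) v.
  rewrite -(nrm_sub_projector v pP).
  by have /test_opP [_ /(_ z) /andP[_ h2]] := tN; exact: h2.
move=> le1; have : (1 + h^-1) * qf (opcompl M) z <= (1 + h^-1) * qf (opcompl P) v.
  by rewrite ler_pM2l // addr_gt0 // invr_gt0.
lra.
Qed.

Lemma test_sandwich M P : test_op M -> projector P -> test_op (opmul P (opmul M P)).
Proof.
move=> /test_opP [hM bM] pP; apply/test_opP; split.
  exact: hermitian_conj hM (proj1 pP).
move=> v; rewrite qf_conj; last exact: (proj1 pP). have /andP[b1 b2] := bM (app P v).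
by rewrite b1 (le_trans b2) // projector_le.
Qed.

(** [P] projects onto the nonnegative eigenspaces of c A - W, an operator that commutes with [A]. On
    the remaining eigenvectors c A is below [W], so the last bound is a Markov inequality for
    traces. *)
Lemma typical_projector A W (c : R) : hermitian A -> psd W -> commuting A W ->
  exists P, [/\ projector P, commuting A P,
    forall v, qf W (app P v) <= c * qf A (app P v)
    & c * retr (opmul A (opcompl P)) <= retr W].
Proof.
move=> hA pW cAW; pose D := opadd (opscale c%:C A) (opopp W).
have hD : hermitian D.
  apply: hermitian_add (hermitian_opp (proj1 pW)); exact: hermitian_scale.
have qD v : qf D v = c * qf A v - qf W v by rewrite qf_add qf_opp qf_scale.
have [[d w] /= [ow DE]] := spectral_exists hD.
pose F (x : R) : R := if 0 <= x then 1 else 0.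
have FF k : (F \o d) k * (F \o d) k = (F \o d) k.
  by rewrite /F /=; case: ifP; rewrite ?mulr1 ?mulr0.
have pP := projector_spop ow FF.
exists (spop (F \o d) w); split=> //.
- apply: commuting_spop => // v; rewrite -DE !app_add !app_opp !app_scale.
  rewrite app_addr app_scaler; apply/funext => x /=; congr (_ + _).
  have -> : (\- app W v) = (fun x => (-1) * app W v x).
    by apply/funext => y; rewrite mulN1r.
  by rewrite app_scaler mulN1r cAW.
- move=> v; rewrite -subr_ge0 -qD {1}DE qf_spop; apply: sumr_ge0 => k _.
  rewrite ip_basis_spop // nsqM nsq_real /F /=.
  case: ifP => [h|_]; last by rewrite expr0n mul0r mulr0.
  by rewrite expr1n mul1r mulr_ge0 ?nsq_ge0.
- rewrite /opcompl retr_one_sub retr_mul_spop (retr_basis ow A) (retr_basis ow W).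
  rewrite -sumrB mulr_sumr; apply: ler_sum => k _.
  have -> : c * (qf A (w k) - (F \o d) k * qf A (w k)) = (1 - F (d k)) * (c * qf A (w k)).
    by rewrite /=; ring.
  have : qf D (w k) = d k.
    rewrite DE /qf app_spop_basis // ip_scaler ip_orth // eqxx mulr1.
    by [].
  rewrite qD /F; case: (leP 0 (d k)) => h; have := psd_qf (w k) pW; rewrite /=; lra.
Qed.

(** Split <u_j|v_i> into its 1 - M and M parts by [nsq_add_le]. The weight there is the [d] of the
    threshold: the second part carries l_i / d, which the restriction on (i, j) bounds by c m_j, the
    weight of the second state. *)
Lemma testing_converse (l m : T -> R) (v u : T -> T -> C) M (c d : R) :
  orthonormal v -> orthonormal u -> (forall k, 0 <= l k) -> (forall k, 0 <= m k) ->
  test_op M -> 0 < d -> 0 < c ->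
  \sum_i \sum_(j | l i <= d * c * m j) l i * nsq (ip (u j) (v i)) <=
  (1 + d) * (retr (opmul (spop l v) (opcompl M)) + c * retr (opmul (spop m u) M)).
Proof.
move=> ov ou l0 m0 tM d0 c0; have tN : test_op (opcompl M) := test_compl tM.
have [hM _] := iffLR (test_opP M) tM.
pose a i j := nsq (ip (u j) (app (opcompl M) (v i))).
pose b i j := nsq (ip (u j) (app M (v i))).
have le1 : \sum_i \sum_j l i * a i j <= retr (opmul (spop l v) (opcompl M)).
  rewrite retr_spop_mul; apply: ler_sum => i _; rewrite -mulr_sumr.
  by rewrite ler_wpM2l // -(parseval ou) test_sqr_le.
have le2 : \sum_i \sum_j m j * b i j <= retr (opmul (spop m u) M).
  rewrite retr_spop_mul exchange_big; apply: ler_sum => j _ /=; rewrite -mulr_sumr.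
  rewrite ler_wpM2l //; apply: le_trans (test_sqr_le _ tM).
  rewrite (parseval ov); apply: ler_sum => i _; rewrite /b.
  by rewrite -nsq_conj ip_conj ip_appC.
apply: (@le_trans _ _ ((1 + d) * (\sum_i \sum_j l i * a i j + c * \sum_i \sum_j m j * b i j))).
  rewrite mulr_sumr -big_split /= mulr_sumr; apply: ler_sum => i _.
  rewrite mulr_sumr -big_split /= mulr_sumr big_mkcond; apply: ler_sum => j _ /=.
  have a0 : 0 <= a i j by apply: nsq_ge0.
  have b0 : 0 <= b i j by apply: nsq_ge0.
  have cm0 : 0 <= c * (m j * b i j) by rewrite !mulr_ge0 // ltW.
  case: ifP => [h|_]; last by rewrite mulr_ge0 ?addr_ge0 ?mulr_ge0 // ?ltW.
  have -> : ip (u j) (v i) = ip (u j) (app (opcompl M) (v i)) + ip (u j) (app M (v i)).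
    by rewrite app_compl ip_subr subrK.
  have le3 := nsq_add_le (ip (u j) (app (opcompl M) (v i))) (ip (u j) (app M (v i))) d0.
  apply: (le_trans (ler_wpM2l (l0 i) le3)).
  rewrite -/(a i j) -/(b i j) mulrCA ler_pM2l ?addr_gt0 // mulrDr lerD2l.
  have -> : l i * (b i j / d) = l i / d * b i j by rewrite mulrA mulrAC.
  by rewrite [leRHS]mulrA ler_wpM2r // ler_pdivrMr // mulrC mulrA.
by rewrite ler_pM2l ?addr_gt0 // lerD // ler_pM2l.
Qed.

(* The test is the positive part of the pinching of the first state by the
   eigenprojections of the second one, minus c times the second one. *)
Lemma testing_achievability (G : finType) (g : T -> G) (mu : G -> R)
    (l : T -> R) (v u : T -> T -> C) (c K : R) :
  orthonormal v -> orthonormal u -> (forall k, 0 <= l k) -> \sum_k l k = 1 ->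
  (forall a, 0 <= mu a) -> 0 < c -> 0 < K ->
  exists M, [/\ test_op M,
    c * retr (opmul (spop (mu \o g) u) M) <= 1 &
    retr (opmul (spop l v) (opcompl M)) <=
      \sum_i \sum_(j | l i <= K * c * mu (g j)) l i * nsq (ip (u j) (v i)) + #|G|%:R / K].
Proof.
move=> ov ou l0 l1 mu0 c0 K0.
pose rho := spop l v; pose Q a := spop (fun j => (g j == a)%:R) u.
have hQ a : hermitian (Q a) by apply: hermitian_spop.
have pQ a : projector (Q a).
  by apply: projector_spop => // k; case: eqP; rewrite ?mulr1 ?mulr0.
have QQ a b w : app (Q a) (app (Q b) w) = if a == b then app (Q a) w else fun=> 0.
  rewrite app_spop_spop //; case: eqP => [->|ne]; last first.
    rewrite app_spop; apply/funext => x; rewrite big1 // => k _.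
    by case: eqP => [->|_]; rewrite ?mul0r // (introF eqP ne) mul1r !mul0r.
  by congr (app (spop _ _) _); apply/funext => k; case: eqP; rewrite ?mulr1 ?mulr0.
have hrho : hermitian rho by apply: hermitian_spop.
pose pin : op R T := fun x y => \sum_a opmul (Q a) (opmul rho (Q a)) x y.
pose D := opadd pin (opopp (opscale c%:C (spop (mu \o g) u))).
have hD : hermitian D.
  apply: hermitian_add; first by apply: hermitian_sum => a; apply: hermitian_conj.
  by apply/hermitian_opp/hermitian_scale/hermitian_spop.
have appD w : app D w = (fun x => \sum_a app (Q a) (app rho (app (Q a) w)) x)
    \- (fun x => c%:C * app (spop (mu \o g) u) w x).
  rewrite app_add app_opp app_scale; apply/funext => x; congr (_ - _).
  rewrite {1}/app /pin; under eq_bigr do rewrite mulr_suml.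
  rewrite exchange_big; apply: eq_bigr => a _ /=.
  by rewrite -[LHS]/(app (opmul (Q a) (opmul rho (Q a))) w x) !app_mul.
have QD a w : app (Q a) (app D w) = app (Q a) (app rho (app (Q a) w))
    \- (fun x => (c * mu a)%:C * app (Q a) w x).
  rewrite appD app_subr app_sumr app_scaler app_spop_spop //.
  apply/funext => x /=; congr (_ - _).
    rewrite (bigD1 a) //= QQ eqxx big1 ?addr0 // => b /negbTE ba.
    by rewrite QQ eq_sym ba.
  rewrite !app_spop !mulr_sumr; apply: eq_bigr => k _ /=.
  case: eqP => [->|_]; last by rewrite !mul0r !mulr0.
  by rewrite !mul1r rmorphM /=; ring.
have [[e w] /= [ow DE]] := spectral_exists hD.
pose F (x : R) : R := if x <= 0 then 1 else 0.
have FF k : (F \o e) k * (F \o e) k = (F \o e) k.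
  by rewrite /F /=; case: ifP; rewrite ?mulr1 ?mulr0.
pose E := spop (F \o e) w.
have pE : projector E := projector_spop ow FF.
(* The pinched state is block diagonal and the second state is the scalar [mu a] on block [a], so D
   and its spectral projection [E] respect the blocks. *)
have cQE a : commuting (Q a) E.
  apply: commuting_spop => // z; rewrite -DE QD appD.
  apply/funext => x /=; congr (_ - _).
    rewrite (bigD1 a) //= QQ eqxx big1 ?addr0 // => b /negbTE ba.
    by rewrite QQ ba !app0.
  rewrite app_spop_spop // !app_spop !mulr_sumr; apply: eq_bigr => k _ /=.
  case: eqP => [->|_]; last by rewrite ?mulr0 ?mul0r ?mulr0.
  by rewrite ?mul1r ?mulr1 rmorphM /=; ring.
exists (opcompl E).
have tE := projector_test pE; split; first exact: test_compl.
- pose Tt := opcompl E.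
  have pos : 0 <= retr (opmul D Tt).
    rewrite [D in opmul D]DE retr_spop_mul; apply: sumr_ge0 => k _.
    rewrite qf_compl nrm_basis // /E qf_spop (bigD1 k) //= ip_orth // eqxx nsq1 mulr1.
    rewrite big1 => [|j /negbTE jk]; last by rewrite ip_orth // jk nsq0 mulr0.
    rewrite addr0 /F /=; case: (leP (e k) 0) => h; first by rewrite subrr mulr0.
    by rewrite subr0 mulr1 ltW.
  (* Pinching is invisible to a test that commutes with every [Q a]: the trace against D is the
     trace against the unpinched difference. *)
  have retD : retr (opmul D Tt) = retr (opmul rho Tt) - c * retr (opmul (spop (mu \o g) u) Tt).
    rewrite retr_spop_mul /retr (optr_basis ou) (optr_basis ou) !Re_sum mulr_sumr -sumrB.
    apply: eq_bigr => j _; rewrite (app_mul D) (app_mul rho) (ip_appC _ _ hD) (ip_appC _ _ hrho).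
    have Qu a : app (Q a) (u j) = if a == g j then u j else fun=> 0.
      rewrite /Q app_spop_basis //; apply/funext => x; rewrite eq_sym.
      by case: eqP => _; rewrite ?mul1r ?mul0r.
    have -> : app D (u j) = app (Q (g j)) (app rho (u j)) \- (fun x => (c * mu (g j))%:C * u j x).
      rewrite appD app_spop_basis //; apply/funext => x /=.
      rewrite rmorphM /= mulrA; congr (_ - _).
      rewrite (bigD1 (g j)) //= Qu eqxx big1 ?addr0 // => a /negbTE aj.
      by rewrite Qu aj !app0.
    rewrite ip_subl Re_add Re_opp; congr (_ - _).
      by rewrite -ip_appC // /Tt app_compl app_subr cQE Qu eqxx.
    by rewrite -ip_conj ip_scaler conjcM conjc_realC ip_conj Re_scale mulrA.
  have le1 : retr (opmul rho Tt) <= 1.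
    rewrite retr_spop_mul -l1; apply: ler_sum => k _.
    rewrite -[leRHS]mulr1 ler_wpM2l // -(nrm_basis ov k).
    by have /test_opP [_ /(_ (v k)) /andP[]] := test_compl tE.
  by move: pos; rewrite retD; lra.
- rewrite retr_spop_mul.
  (* The [Q a] resolve the identity and commute with [E], so the error splits over the blocks. *)
  have -> : \sum_k l k * qf (opcompl (opcompl E)) (v k) =
            \sum_k l k * \sum_a nrm (app E (app (Q a) (v k))).
    apply: eq_bigr => k _; congr (_ * _); rewrite !qf_compl opprB addrC subrK.
    have -> : qf E (v k) = Re (ip (app E (v k)) (fun x => \sum_a app (Q a) (v k) x)).
      rewrite /qf ip_appC; last exact: hermitian_spop.
      congr (Re (ip _ _)); rewrite [LHS](basis_expand ou); apply/funext => x.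
      under [RHS]eq_bigr do rewrite app_spop.
      rewrite exchange_big; apply: eq_bigr => j _ /=.
      rewrite (bigD1 (g j)) //= eqxx mul1r big1 ?addr0 // => a /negbTE.
      by rewrite eq_sym => ->; rewrite !mul0r.
    rewrite ip_sumr Re_sum; apply: eq_bigr => a _.
    rewrite -(qf_projector _ pE) /qf -ip_appC; last exact: hermitian_spop.
    rewrite -[RHS]Re_conj ip_conj -ip_appC; last exact: hermitian_spop.
    by rewrite -ip_appC // -cQE (proj2 (pQ a)) cQE ip_nrm_Re -ip_appC //; exact: hermitian_spop.
  (* Put z = E Q_a v_i. As z lies in block [a] and in the range of [E], <z|rho|z> is at most c mu_a
     |z|^2; as rho dominates l_i |v_i><v_i| and <v_i|z> = |z|^2, it is at least l_i |z|^4. *)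
  have key i a : nrm (app E (app (Q a) (v i))) * l i <= c * mu a.
    set z := app E (app (Q a) (v i)).
    have Ez : app E z = z by rewrite /z (proj2 pE).
    have Qz : app (Q a) z = z by rewrite /z cQE (proj2 (pQ a)).
    have zv : ip (v i) z = (nrm z)%:C.
      rewrite -[LHS]ip_conj -[RHS]conjc_realC -ipvv; congr (conjc _).
      by rewrite -{1}Qz -(ip_appC _ _ (hQ a)) -{1}Ez -(ip_appC _ _ (proj1 pE)).
    have D0 : qf D z <= 0.
      rewrite DE qf_spop -oppr_ge0 -sumrN; apply: sumr_ge0 => k _.
      rewrite -Ez ip_basis_spop // nsqM nsq_real /F /=.
      case: (leP (e k) 0) => h; last by rewrite expr0n !mul0r mulr0 oppr0.
      by rewrite expr1n mul1r -mulNr mulr_ge0 ?nsq_ge0 // oppr_ge0.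
    have D1 : qf D z = qf rho z - c * mu a * nrm z.
      rewrite /qf -{1}Qz -ip_appC // QD Qz ip_subr ip_scaler Re_add Re_opp Re_scale -nrmE.
      by rewrite ip_appC // Qz.
    have r0 : l i * nrm z ^+ 2 <= qf rho z.
      rewrite /rho qf_spop (bigD1 i) //= zv nsq_real lerDl.
      by apply: sumr_ge0 => k _; rewrite mulr_ge0 ?nsq_ge0.
    have : nrm z * l i * nrm z <= c * mu a * nrm z.
      by apply: le_trans (_ : qf rho z <= _); [move: r0; rewrite expr2; lra | lra].
    have [nz _|nz] := eqVneq (nrm z) 0; last by rewrite ler_pM2r // lt_def nz nrm_ge0.
    by rewrite nz mul0r mulr_ge0 // ltW.
  have -> : #|G|%:R / K = \sum_i \sum_(a : G) l i / K.
    transitivity ((\sum_i l i) * (#|G|%:R / K)); first by rewrite l1 mul1r.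
    rewrite mulr_suml; apply: eq_bigr => i _.
    by rewrite sumr_const mulrCA mulr_natl; congr (_ *+ _); apply: eq_card.
  rewrite -big_split; apply: ler_sum => i _ /=.
  have -> : \sum_(j | l i <= K * c * mu (g j)) l i * nsq (ip (u j) (v i)) =
    \sum_a (if l i <= K * c * mu a then l i * nrm (app (Q a) (v i)) else 0).
    have nQ a : l i * nrm (app (Q a) (v i)) =
                \sum_(j | g j == a) l i * nsq (ip (u j) (v i)).
      rewrite -qf_projector // /Q qf_spop mulr_sumr [RHS]big_mkcond.
      by apply: eq_bigr => j _; case: eqP; rewrite ?mul1r ?mul0r ?mulr0.
    rewrite (partition_big g predT) //= ; apply: eq_bigr => a _.
    case: ifP => h.
      rewrite nQ; apply: eq_bigl => j; case: eqP => [->|]; rewrite ?andbF ?andbT //.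
    rewrite big_pred0 // => j; apply/negP => /andP[+ /eqP e0]; rewrite e0 h //.
  rewrite mulr_sumr -big_split; apply: ler_sum => a _ /=.
  have := key i a; set N := nrm _ => kia.
  have N0 : 0 <= N by apply: nrm_ge0.
  case: (leP (l i) (K * c * mu a)) => h.
    rewrite (@le_trans _ _ (l i * nrm (app (Q a) (v i)))) ?ler_wpM2l ?projector_le //.
    by rewrite lerDl divr_ge0 // ltW.
  rewrite add0r mulrC ler_pdivlMr // (le_trans (ler_wpM2r (ltW K0) kia)) //.
  by rewrite mulrC mulrA ltW.
Qed.

End OneSystem.
End Testing.

(** * Tensor powers and permutation invariance *)

Section TensorPowers.
Variable R : realType.
Local Notation C := R[i].
Local Notation "x %:C" := (real_complex R x) : ring_scope.
Local Notation Re := (@complex.Re R).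
Local Notation "T ^^ n" := {ffun 'I_n -> T} (at level 30).

Lemma realCM (a b : R) : (a * b)%:C = a%:C * b%:C.
Proof. exact: rmorphM. Qed.

Lemma ip_cauchy_schwarz (T : finType) (v w : T -> C) :
  nsq (ip v w) <= nrm v * nrm w.
Proof.
set a := ip v w.
set X := (fun x => (nrm v)%:C * w x) \- (fun x => a * v x).
have : 0 <= nrm X by apply: nrm_ge0.
have E : ip X X = (nrm v * (nrm v * nrm w - nsq a))%:C.
  rewrite /X ip_subr !ip_subl !ip_scaler !ip_scalel conjc_realC !ipvv.
  by rewrite -/a -(ip_conj v w) -/a !(rmorphM, rmorphB) /= -nsqE; ring.
rewrite nrmE E /=.
have [nv|nv] := eqVneq (nrm v) 0.
  move=> _; suff -> : a = 0 by rewrite nsq0 nv mul0r.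
  rewrite /a /ip big1 // => x _.
  have : nsq (v x) = 0.
    by apply/eqP; move/eqP: nv; rewrite psumr_eq0 => [/allP/(_ x)|y _]; [apply; rewrite mem_index_enum|apply: nsq_ge0].
  move=> vx; have /eqP := nsqE (v x); rewrite vx mulf_eq0 conjc_eq0 orbb => /eqP ->.
  by rewrite conjc0 mul0r.
by rewrite pmulr_rge0 ?subr_ge0 // lt_def nv nrm_ge0.
Qed.

Lemma nrm_ipJ (T : finType) (v w : T -> C) :
  nsq (\sum_x v x * w x) <= (\sum_x nsq (v x)) * nrm w.
Proof.
have := ip_cauchy_schwarz (fun x => conjc (v x)) w.
have -> : nrm (fun x => conjc (v x)) = \sum_x nsq (v x).
  by apply: eq_bigr => x _; rewrite nsq_conj.
by rewrite /ip; under eq_bigr do rewrite conjcK.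
Qed.

Lemma density_spectral (T : finType) (A : op R T) : density A ->
  exists lv : (T -> R) * (T -> T -> C),
  [/\ orthonormal lv.2, A = spop lv.1 lv.2, forall k, 0 <= lv.1 k & \sum_k lv.1 k = 1].
Proof.
move=> [pA tA]; have [[l v] /= [ov AE l0]] := psd_spectral pA.
exists (l, v); split=> //=; rewrite -(retr_spop ov) -AE /retr tA //.
Qed.

Lemma density_spop (T : finType) l (v : T -> T -> C) : orthonormal v ->
  (forall k, 0 <= l k) -> \sum_k l k = 1 -> density (spop l v).
Proof.
move=> ov l0 l1; split; first exact: psd_spop.
rewrite (optr_basis ov) -[RHS]/(1%:C) -l1 realC_sum; apply: eq_bigr => k _.
by rewrite app_spop_basis // ip_scaler ip_orth // eqxx mulr1.
Qed.

Section Power.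
Variables (T : finType) (n : nat).
Implicit Types (v u : T -> T -> C) (A B : op R T).

Definition pow_basis v : T ^^ n -> T ^^ n -> C := fun k x => \prod_i v (k i) (x i).
Definition pow_eig (l : T -> R) : T ^^ n -> R := fun k => \prod_i l (k i).

Lemma ip_pow_basis v u k l :
  ip (pow_basis v k) (pow_basis u l) = \prod_i ip (v (k i)) (u (l i)).
Proof.
rewrite /ip (bigA_distr_bigA (fun i x => conjc (v (k i) x) * u (l i) x)) /=.
apply: eq_bigr => x _; rewrite /pow_basis rmorph_prod -big_split.
by apply: eq_bigr.
Qed.

Lemma orthonormal_pow v : orthonormal v -> orthonormal (pow_basis v).
Proof.
move=> ov k l; rewrite -[LHS]/(ip _ _) ip_pow_basis.
under eq_bigr do rewrite ip_orth //.
have [->|ne] := eqVneq k l; first by rewrite big1 // => i _; rewrite eqxx.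
have [i ki] : exists i, k i != l i.
  apply/existsP; rewrite -negb_forall; apply: contra ne => /forallP h.
  by apply/eqP/ffunP => i; apply/eqP.
by rewrite (bigD1 i) //= (negbTE ki) mul0r.
Qed.

Lemma optpow_spop l v : @optpow R T n (spop l v) = spop (pow_eig l) (pow_basis v).
Proof.
apply/funext => x; apply/funext => y; rewrite /optpow /spop.
rewrite (bigA_distr_bigA (fun i k => (l k)%:C * v k (x i) * conjc (v k (y i)))) /=.
apply: eq_bigr => k _; rewrite !big_split /= /pow_eig /pow_basis !rmorph_prod.
by [].
Qed.

Lemma sum_pow_eig l : \sum_k pow_eig l k = (\sum_k l k) ^+ n.
Proof.
by rewrite -(bigA_distr_bigA (fun=> l)) prodr_const card_ord.
Qed.

Lemma pow_eig_ge0 l : (forall k, 0 <= l k) -> forall k, 0 <= pow_eig l k.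
Proof. by move=> l0 k; apply: prodr_ge0. Qed.

Lemma density_optpow A : density A -> density (@optpow R T n A).
Proof.
move=> /density_spectral [[l v] /= [ov -> l0 l1]]; rewrite optpow_spop.
apply: density_spop; [exact: orthonormal_pow|exact: pow_eig_ge0|].
by rewrite sum_pow_eig l1 expr1n.
Qed.

Lemma perm_inv_optpow A : perm_inv (@optpow R T n A).
Proof.
move=> s x y; rewrite /optpow [RHS](reindex_inj (@perm_inj _ s)).
by apply: eq_bigr => i _; rewrite !ffunE.
Qed.

End Power.

(** * Permutation-invariant states and the universal operator *)

Section PermutationInvariance.
Variable n : nat.

Definition pact (T : finType) (x : T ^^ n) (s : 'S_n) : T ^^ n := [ffun i => x (s i)].

Lemma pactM (T : finType) (x : T ^^ n) s t : pact (pact x s) t = pact x (t * s)%g.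
Proof. by apply/ffunP => i; rewrite !ffunE permM. Qed.

Lemma pact1 (T : finType) (x : T ^^ n) : pact x 1%g = x.
Proof. by apply/ffunP => i; rewrite !ffunE perm1. Qed.

Lemma pactK (T : finType) s : cancel (@pact T ^~ s) (@pact T ^~ s^-1%g).
Proof. by move=> x; rewrite pactM mulVg pact1. Qed.

Lemma pactKV (T : finType) s : cancel (@pact T ^~ s^-1%g) (@pact T ^~ s).
Proof. by move=> x; rewrite pactM mulgV pact1. Qed.

Lemma pact_eq_sym (T : finType) (x y : T ^^ n) s : (pact x s == y) = (pact y s^-1%g == x).
Proof. by apply/eqP/eqP => <-; rewrite ?pactK ?pactKV. Qed.

Lemma pact_bij (T : finType) s : bijective (@pact T ^~ s).
Proof. exact: (Bijective (@pactK T s) (@pactKV T s)). Qed.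

(* The averaging over the action of S_n on pairs: the entry is the probability
   that a uniformly random permutation maps (e, x) to (e', x'). *)
Definition symavg (T : finType) (e x e' x' : T ^^ n) : R :=
  (n`!%:R)^-1 * \sum_(s : 'S_n) ((pact e s == e') && (pact x s == x'))%:R.

Lemma symavg_sym (T : finType) (e x e' x' : T ^^ n) : symavg e x e' x' = symavg e' x' e x.
Proof.
rewrite /symavg; congr (_ * _); rewrite (reindex_inj (@invg_inj _)) /=.
by apply: eq_bigr => s _; rewrite !(pact_eq_sym _ _ s^-1%g) invgK.
Qed.

Lemma fact_R_neq0 : (n`!%:R : R) != 0.
Proof. by rewrite pnatr_eq0 -lt0n fact_gt0. Qed.

Lemma symavg_sum (T : finType) (e x : T ^^ n) (F : T ^^ n -> T ^^ n -> C) :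
  \sum_e' \sum_x' (symavg e x e' x')%:C * F e' x' =
  (n`!%:R^-1)%:C * \sum_(s : 'S_n) F (pact e s) (pact x s).
Proof.
rewrite mulr_sumr.
under eq_bigr => e' _.
  under eq_bigr => x' _.
    rewrite /symavg realCM realC_sum mulr_sumr mulr_suml; over.
  rewrite exchange_big; over.
rewrite exchange_big; apply: eq_bigr => s _ /=.
rewrite (bigD1 (pact e s)) //= (bigD1 (pact x s)) //= !eqxx.
rewrite big1 => [|x' /negbTE xx]; last by rewrite eq_sym xx /= mulr0 mul0r.
rewrite big1 => [|e' /negbTE ee]; last first.
  by rewrite big1 // => x' _; rewrite eq_sym ee /= mulr0 mul0r.
by rewrite !addr0 mulr1.
Qed.

(** Together with [symavg_sym], this makes the averaging an orthogonal projection, whose range is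
    the symmetric subspace of n copies of T (x) T. *)
Lemma symavg_idem (T : finType) (e x f y : T ^^ n) :
  \sum_e' \sum_x' (symavg e x e' x')%:C * (symavg e' x' f y)%:C = (symavg e x f y)%:C.
Proof.
rewrite symavg_sum.
have E s : symavg (pact e s) (pact x s) f y = symavg e x f y.
  rewrite /symavg; congr (_ * _); rewrite [RHS](reindex_inj (@mulIg _ s)) /=.
  by apply: eq_bigr => t _; rewrite !pactM.
under eq_bigr do rewrite E.
rewrite -realC_sum -rmorphM; congr (_%:C).
by rewrite sumr_const card_Sn -[X in _ * X]mulr_natl mulKf // fact_R_neq0.
Qed.

(** The partial trace, over the first copy of T^n, of the projection onto the symmetric subspace. It
    is not normalised. *)
Definition universal_state (T : finType) : op R (T ^^ n) :=
  fun x y => (\sum_(e : T ^^ n) symavg e x e y)%:C.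

Lemma hermitian_universal (T : finType) : hermitian (@universal_state T).
Proof.
move=> x y; rewrite /cconj /universal_state conjc_realC; congr (_%:C).
by apply: eq_bigr => e _; apply: symavg_sym.
Qed.

(** A projection is its own square, so its partial trace has a form that is a sum of squares. *)
Lemma qf_universal (T : finType) (v : T ^^ n -> C) :
  qf (@universal_state T) v =
  \sum_e \sum_e' \sum_x' nsq (\sum_y (symavg e y e' x')%:C * v y).
Proof.
transitivity (Re (\sum_e \sum_x \sum_y conjc (v x) * (symavg e x e y)%:C * v y)).
  congr (Re _); rewrite /ip exchange_big; apply: eq_bigr => x _.
  rewrite exchange_big /app mulr_sumr; apply: eq_bigr => y _ /=.
  by rewrite /universal_state realC_sum mulr_suml mulr_sumr; apply: eq_bigr => e _; rewrite mulrA.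
rewrite Re_sum; apply: eq_bigr => e _.
transitivity (Re (\sum_e' \sum_x' \sum_x \sum_y
   conjc (v x) * ((symavg e x e' x')%:C * (symavg e' x' e y)%:C) * v y)).
  congr (Re _); symmetry.
  under eq_bigr do rewrite exchange_big.
  rewrite exchange_big; apply: eq_bigr => x _ /=.
  under eq_bigr do rewrite exchange_big.
  rewrite exchange_big; apply: eq_bigr => y _ /=.
  rewrite -symavg_idem mulr_sumr mulr_suml; apply: eq_bigr => e' _.
  by rewrite mulr_sumr mulr_suml.
rewrite Re_sum; apply: eq_bigr => e' _; rewrite Re_sum; apply: eq_bigr => x' _.
rewrite -[RHS]/(Re (nsq _)%:C) -nsqE; congr (Re _).
rewrite conjc_sum mulr_suml; apply: eq_bigr => x _; rewrite mulr_sumr.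
apply: eq_bigr => y _; rewrite conjcM conjc_realC (symavg_sym e' x'); ring.
Qed.

Lemma psd_universal (T : finType) : psd (@universal_state T).
Proof.
apply/psdP; split=> [|v]; first exact: hermitian_universal.
by rewrite qf_universal; do 3!apply: sumr_ge0 => ? _; apply: nsq_ge0.
Qed.

Lemma perm_inv_commuting (T : finType) (A : op R (T ^^ n)) : perm_inv A <->
  forall s v, app A (fun x => v (pact x s)) = fun x => app A v (pact x s).
Proof.
split=> [pA s v|h s x y].
  apply/funext => x; rewrite /app [RHS](reindex (@pact T ^~ s)) /=; last first.
    exact/onW_bij/pact_bij.
  by apply: eq_bigr => y _; rewrite -(pA s).
have := congr1 (@^~ x) (h s (fun z => (z == pact y s)%:R)); rewrite /= /app.
rewrite (bigD1 y) //= eqxx mulr1 big1 => [|z /negbTE zy]; last first.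
  by rewrite (inj_eq (can_inj (@pactK T s))) zy mulr0.
rewrite addr0 (bigD1 (pact y s)) //= eqxx mulr1 big1 => [|z /negbTE ->]; last by rewrite mulr0.
by rewrite addr0 => ->.
Qed.

(** Invariance means commuting with the permutation operators ([X] below), and [commuting_spop]
    passes this on to the square root. *)
Lemma perm_inv_sqrt (T : finType) (A : op R (T ^^ n)) : psd A -> perm_inv A ->
  exists B, [/\ hermitian B, perm_inv B & opmul B B = A].
Proof.
move=> pA iA; have [[l v] /= [ov AE l0]] := psd_spectral pA.
exists (spop (Num.sqrt \o l) v); split; first exact: hermitian_spop.
  apply/perm_inv_commuting => s w.
  pose X : op R (T ^^ n) := fun x y => (pact x s == y)%:R.
  have XE z : app X z = fun x => z (pact x s).
    apply/funext => x; rewrite /app (bigD1 (pact x s)) //= /X eqxx mul1r big1 ?addr0 // => y.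
    by rewrite eq_sym => /negbTE ->; rewrite mul0r.
  have cX : commuting X (spop l v).
    by move=> z; rewrite -AE !XE; symmetry; apply: (iffLR (perm_inv_commuting A)).
  by rewrite -!XE -(commuting_spop ov Num.sqrt cX).
rewrite AE; apply: app_inj => w; rewrite app_mul app_spop_spop //.
by congr (app (spop _ _) _); apply/funext => k /=; rewrite -expr2 sqr_sqrtr.
Qed.

(* Cauchy-Schwarz applied to a permutation-invariant square root of the state,
   which is a unit vector fixed by the averaging symavg. *)
Lemma sym_state_le_universal (T : finType) (S : op R (T ^^ n)) v :
  sym_state S -> qf S v <= qf (@universal_state T) v.
Proof.
move=> [[pS tS] iS]; have [B [hB iB BB]] := perm_inv_sqrt pS iS.
have B1 : \sum_(z : (T ^^ n) * (T ^^ n)) nsq (B z.1 z.2) = 1.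
  rewrite -(pair_bigA _ (fun e x => nsq (B e x))) /=.
  transitivity (retr S); last by rewrite /retr tS.
  rewrite -BB /retr /optr Re_sum; apply: eq_bigr => e _.
  rewrite /opmul Re_sum; apply: eq_bigr => x _.
  by rewrite (hB e x) /cconj mulrC nsqE.
have -> : qf S v = nrm (app B v) by rewrite -BB /qf app_mul ip_appC // nrmE.
rewrite qf_universal; apply: ler_sum => e _.
have -> : app B v e = \sum_(z : (T ^^ n) * (T ^^ n)) B z.1 z.2 *
    (\sum_y (symavg e y z.1 z.2)%:C * v y).
  rewrite /app; under [RHS]eq_bigr do rewrite mulr_sumr.
  rewrite exchange_big; apply: eq_bigr => y _ /=.
  rewrite -(pair_bigA _ (fun e' x' => B e' x' * ((symavg e y e' x')%:C * v y))) /=.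
  have := symavg_sum e y B.
  have -> : \sum_(s : 'S_n) B (pact e s) (pact y s) = \sum_(s : 'S_n) B e y.
    by apply: eq_bigr => s _; exact: iB.
  rewrite sumr_const card_Sn -[X in _ = _ * X]mulr_natl mulrA fmorphV rmorph_nat.
  rewrite mulVf ?mul1r; last by rewrite pnatr_eq0 -lt0n fact_gt0.
  move=> <-; rewrite mulr_suml; apply: eq_bigr => e' _.
  by rewrite mulr_suml; apply: eq_bigr => x' _; ring.
rewrite (pair_bigA _ (fun e' x' => nsq (\sum_y (symavg e y e' x')%:C * v y))) /=.
by rewrite (le_trans (nrm_ipJ _ _)) // B1 mul1r.
Qed.

(** The universal operator is a linear combination of permutation operators: s has as coefficient
    its number of fixed points on T^n, divided by n!. *)
Lemma commuting_universal (T : finType) (A : op R (T ^^ n)) : perm_inv A ->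
  commuting A (@universal_state T).
Proof.
move=> iA; have := iffLR (perm_inv_commuting A) iA => {}iA.
have UE v : app (@universal_state T) v = fun x => \sum_(s : 'S_n)
    (n`!%:R^-1 * \sum_(e : T ^^ n) (pact e s == e)%:R)%:C * v (pact x s).
  apply/funext => x; rewrite /app /universal_state.
  under eq_bigr => y _.
    rewrite /symavg -mulr_sumr exchange_big mulr_sumr realC_sum mulr_suml; over.
  rewrite exchange_big; apply: eq_bigr => s _ /=.
  rewrite (bigD1 (pact x s)) //= [X in _ + X]big1 => [|y /negbTE yx]; last first.
    by rewrite eq_sym yx big1 ?mulr0 ?mul0r // => e _; rewrite andbF.
  rewrite addr0; congr (_%:C * _); congr (_ * _); apply: eq_bigr => e _.
  by rewrite eqxx andbT.
move=> v; rewrite !UE app_sumr; apply/funext => x; apply: eq_bigr => s _.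
by rewrite app_scaler iA.
Qed.

(** Counts are stored in ['I_n.+1] so that the types form a finite type with (n+1)^#|U| elements,
    the source of all polynomial factors. *)
Definition type_class (U : finType) (z : U ^^ n) : {ffun U -> 'I_n.+1} :=
  [ffun u => inord #|[pred i | z i == u]|].

Lemma type_classE (U : finType) (z : U ^^ n) u : type_class z u = #|[pred i | z i == u]| :> nat.
Proof. by rewrite ffunE inordK // ltnS -[X in (_ <= X)%N]card_ord max_card. Qed.

Lemma type_class_pact (U : finType) (z z' : U ^^ n) : type_class z = type_class z' ->
  exists s, z = pact z' s.
Proof.
move=> h; have /tuple_permP [s hs] : perm_eq [tuple z i | i < n] [tuple z' i | i < n].
  apply/allP => u _ /=.
  have E (y : U ^^ n) : count_mem u [tuple y i | i < n] = type_class y u.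
    by rewrite type_classE /= count_map -sum1_count big_enum_cond /= sum1_card.
  by rewrite !E h.
exists s; apply/ffunP => i; rewrite ffunE.
have := congr1 (fun t => tnth t i) (val_inj hs).
by rewrite !tnth_mktuple.
Qed.

(** A Burnside count, as an injection (z, s) |-> (type of z, s * p z), where [p z] takes the
    representative of the type to z. Since s fixes z, the product also takes the representative to
    z; so the image determines z, and then s. *)
Lemma card_stab_le (U : finType) :
  (\sum_(z : U ^^ n) \sum_(s : 'S_n) (pact z s == z) <= n.+1 ^ #|U| * n`!)%N.
Proof.
pose rep z := odflt z [pick z' | @type_class U z' == type_class z].
have repP (z : U ^^ n) : exists s, z == pact (rep z) s.
  suff /type_class_pact [s E] : type_class z = type_class (rep z) by exists s; apply/eqP.
  by rewrite /rep; case: pickP => [z' /eqP //|/(_ z)]; rewrite eqxx.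
have rep_eq z z' : type_class z = type_class z' -> rep z = rep z'.
  move=> h; rewrite /rep h; case: pickP => //= /(_ z'); by rewrite eqxx.
pose p z := xchoose (repP z).
have pP z : z = pact (rep z) (p z) by apply/eqP; apply: xchooseP (repP z).
pose S := [pred zs : (U ^^ n) * 'S_n | pact zs.1 zs.2 == zs.1].
have -> : (\sum_(z : U ^^ n) \sum_(s : 'S_n) (pact z s == z) = #|S|)%N.
  rewrite pair_big /= -sum1_card big_mkcond [RHS]big_mkcond.
  by apply: eq_bigr => -[z s] _; rewrite /= inE /=; case: eqP.
pose f (zs : (U ^^ n) * 'S_n) := (type_class zs.1, (zs.2 * p zs.1)%g).
have fI : {in S &, injective f}.
  move=> [z s] [z' s']; rewrite !inE /= => /eqP hz /eqP hz' [tz sp].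
  have E : z = z'.
    have key y t : pact y t = y -> y = pact (rep y) (t * p y)%g by rewrite -pactM -pP.
    by rewrite (key _ _ hz) [RHS](key _ _ hz') sp (rep_eq _ _ tz).
  by move: sp; rewrite E => /mulIg ->.
rewrite -(card_in_imset fI) (leq_trans (max_card _)) // card_prod card_ffun card_ord.
by rewrite card_Sn.
Qed.

Lemma sum_ffun_pair (K : Type) (idx : K) (aop : Monoid.com_law idx) (TA TB : finType)
    (F : TA ^^ n -> TB ^^ n -> K) :
  \big[aop/idx]_(z : (TA * TB)%type ^^ n) F [ffun i => (z i).1] [ffun i => (z i).2] =
  \big[aop/idx]_a \big[aop/idx]_b F a b.
Proof.
rewrite pair_big /=.
pose h (ab : (TA ^^ n) * (TB ^^ n)) : (TA * TB)%type ^^ n := [ffun i => (ab.1 i, ab.2 i)].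
pose g (z : (TA * TB)%type ^^ n) : (TA ^^ n) * (TB ^^ n) :=
  ([ffun i => (z i).1], [ffun i => (z i).2]).
rewrite (reindex h) /=; last first.
  apply: onW_bij; exists g.
    by case=> a b; congr pair; apply/ffunP => i; rewrite !ffunE.
  by move=> z; apply/ffunP => i; rewrite !ffunE /=; case: (z i).
by apply: eq_bigr => -[a b] _; congr (F _ _); apply/ffunP => i; rewrite !ffunE.
Qed.

(** The trace is the dimension of the symmetric subspace, that is, the average number of fixed
    points of a permutation acting on n-tuples of pairs. *)
Lemma retr_universal_le (T : finType) :
  retr (@universal_state T) <= (n.+1 ^ (#|T| * #|T|))%:R.
Proof.
rewrite /retr /optr /universal_state -realC_sum /=.
have -> : \sum_(x : T ^^ n) \sum_(e : T ^^ n) symavg e x e x =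
  n`!%:R^-1 * (\sum_(z : (T * T)%type ^^ n) \sum_(s : 'S_n) (pact z s == z))%:R.
  rewrite natr_sum.
  transitivity (\sum_(x : T ^^ n) \sum_(e : T ^^ n) symavg x e x e).
    rewrite exchange_big; by do 2!apply: eq_bigr => ? _.
  rewrite -(@sum_ffun_pair _ _ _ _ _ (fun e x => symavg e x e x)) mulr_sumr.
  apply: eq_bigr => z _; rewrite /symavg natr_sum; congr (_ * _).
  apply: eq_bigr => s _; congr (_%:R); congr nat_of_bool.
  apply/andP/eqP => [[/eqP /ffunP h1 /eqP /ffunP h2]|h].
    apply/ffunP => i; move: (h1 i) (h2 i); rewrite !ffunE.
    by case: (z (s i)) (z i) => [a b] [c d] /= -> ->.
  by split; apply/eqP/ffunP => i; rewrite !ffunE -[in RHS]h ffunE.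
rewrite ler_pdivrMl ?ltr0n ?fact_gt0 // -natrM ler_nat mulnC -card_prod.
by apply: leq_trans (card_stab_le _) _; rewrite mulnC.
Qed.

End PermutationInvariance.
End TensorPowers.

(** * Tests against products of permutation-invariant states *)

Section Bipartite.
Variable R : realType.
Local Notation C := R[i].
Local Notation "x %:C" := (real_complex R x) : ring_scope.
Local Notation Re := (@complex.Re R).
Local Notation "T ^^ n" := {ffun 'I_n -> T} (at level 30).
Variables TA TB : finType.
Local Notation TAB := (TA * TB)%type.

Definition tens_basis (u : TA -> TA -> C) (w : TB -> TB -> C) : TAB -> TAB -> C :=
  fun k x => u k.1 x.1 * w k.2 x.2.

Lemma orthonormal_tens u w : orthonormal u -> orthonormal w ->
  orthonormal (tens_basis u w).
Proof.
move=> ou ow [k1 k2] [l1 l2].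
transitivity (ip (u k1) (u l1) * ip (w k2) (w l2)).
  rewrite /ip big_distrlr pair_bigA; apply: eq_bigr => -[x y] _ /=.
  by rewrite /tens_basis /cconj conjcM /=; ring.
by rewrite !ip_orth // -natrM mulnb xpair_eqE.
Qed.

Lemma optens_spop a u b w :
  optens (spop a u) (spop b w) =
  spop (fun k : TAB => a k.1 * b k.2) (tens_basis u w).
Proof.
apply/funext => x; apply/funext => y; rewrite /optens /spop big_distrlr pair_bigA.
by apply: eq_bigr => -[k l] _; rewrite /tens_basis /= realCM conjcM; ring.
Qed.

Lemma psd_ptrB (rho : op R TAB) : psd rho -> psd (ptrB rho).
Proof.
move=> /psd_spectral [[l v] /= [_ -> l0]].
suff -> : ptrB (spop l v) =
  ketbras (fun kb : TAB * TB => l kb.1) (fun kb a => v kb.1 (a, kb.2)).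
  by apply: psd_ketbras => -[k b]; apply: l0.
apply/funext => a; apply/funext => a'; rewrite /ptrB /spop /ketbras exchange_big.
by rewrite pair_bigA.
Qed.

Lemma psd_ptrA (rho : op R TAB) : psd rho -> psd (ptrA rho).
Proof.
move=> /psd_spectral [[l v] /= [_ -> l0]].
suff -> : ptrA (spop l v) =
  ketbras (fun kb : TAB * TA => l kb.1) (fun kb b => v kb.1 (kb.2, b)).
  by apply: psd_ketbras => -[k b]; apply: l0.
apply/funext => a; apply/funext => a'; rewrite /ptrA /spop /ketbras exchange_big.
by rewrite pair_bigA.
Qed.

Lemma density_ptrB (rho : op R TAB) : density rho -> density (ptrB rho).
Proof.
move=> [pr tr]; split; first exact: psd_ptrB.
rewrite -tr /optr /ptrB pair_bigA.
by apply: eq_bigr => -[].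
Qed.

Lemma density_ptrA (rho : op R TAB) : density rho -> density (ptrA rho).
Proof.
move=> [pr tr]; split; first exact: psd_ptrA.
rewrite -tr /optr /ptrA exchange_big pair_bigA.
by apply: eq_bigr => -[].
Qed.

Section PowerSystems.
Variable n : nat.
Implicit Types (S : op R (TA ^^ n)) (U : op R (TB ^^ n)) (M : op R (TAB ^^ n)).
Local Notation fstn x := [ffun i => (x i).1].
Local Notation sndn x := [ffun i => (x i).2].

Lemma tens_n_optpow (A : op R TA) (B : op R TB) :
  tens_n (@optpow R TA n A) (@optpow R TB n B) = @optpow R TAB n (optens A B).
Proof.
apply/funext => x; apply/funext => y; rewrite /tens_n /optpow -big_split.
by apply: eq_bigr => i _; rewrite !ffunE.
Qed.

Definition tens_vec (y : TA ^^ n -> C) (z : TB ^^ n -> C) : TAB ^^ n -> C :=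
  fun x => y (fstn x) * z (sndn x).

Lemma tens_n_spop p y q z : tens_n (spop p y) (spop q z) =
  ketbras (fun kl : (TA ^^ n) * (TB ^^ n) => p kl.1 * q kl.2)
    (fun kl => tens_vec (y kl.1) (z kl.2)).
Proof.
apply/funext => x; apply/funext => x'; rewrite /tens_n /spop /ketbras big_distrlr pair_bigA.
by apply: eq_bigr => -[k l] _; rewrite /tens_vec /= realCM conjcM; ring.
Qed.

Lemma psd_tens_n S U : psd S -> psd U -> psd (tens_n S U).
Proof.
move=> /psd_spectral [[p y] /= [_ -> p0]] /psd_spectral [[q z] /= [_ -> q0]].
by rewrite tens_n_spop; apply: psd_ketbras => -[k l]; rewrite mulr_ge0.
Qed.

Lemma retr_mul_psd_ge0 (T : finType) (A B : op R T) : psd A -> psd B ->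
  0 <= retr (opmul A B).
Proof.
move=> /psd_spectral [[p y] /= [_ -> p0]] pB.
by rewrite retr_spop_mul; apply: sumr_ge0 => k _; rewrite mulr_ge0 ?psd_qf.
Qed.

Lemma tens_n_mul S S' U U' :
  opmul (tens_n S U) (tens_n S' U') = tens_n (opmul S S') (opmul U U').
Proof.
apply/funext => x; apply/funext => y; rewrite /opmul /tens_n big_distrlr /=.
rewrite -(@sum_ffun_pair n _ _ _ _ _ (fun a b => S (fstn x) a * S' a (fstn y) *
  (U (sndn x) b * U' b (sndn y)))).
by apply: eq_bigr => z _; ring.
Qed.

Lemma hermitian_tens_n S U : hermitian S -> hermitian U -> hermitian (tens_n S U).
Proof. by move=> hS hU x y; rewrite /tens_n hS hU /cconj conjcM. Qed.

Lemma projector_idem (T : finType) (P : op R T) : projector P -> opmul P P = P.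
Proof. by move=> [_ iP]; apply: app_inj => v; rewrite app_mul iP. Qed.

Lemma projector_tens_n S U : projector S -> projector U -> projector (tens_n S U).
Proof.
move=> pS pU; split=> [|v]; first exact: hermitian_tens_n (proj1 pS) (proj1 pU).
by rewrite -app_mul tens_n_mul !projector_idem.
Qed.

Lemma projector_compl (T : finType) (P : op R T) : projector P -> projector (opcompl P).
Proof.
move=> [hP iP]; split=> [|v].
  by apply: hermitian_add (hermitian_opp hP); exact: hermitian_one.
by rewrite !app_compl app_subr iP; apply/funext => x /=; rewrite subrr subr0.
Qed.

Lemma psd_projector (T : finType) (P : op R T) : projector P -> psd P.
Proof. by move=> /projector_test []. Qed.

Lemma retr_tens_addl S S' U M :
  retr (opmul (tens_n (opadd S S') U) M) =
  retr (opmul (tens_n S U) M) + retr (opmul (tens_n S' U) M).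
Proof.
rewrite /retr -Re_add; congr (Re _); rewrite /optr -big_split; apply: eq_bigr => x _.
rewrite /opmul -big_split; apply: eq_bigr => y _ /=.
by rewrite /tens_n /opadd; ring.
Qed.

Lemma retr_tens_addr S U U' M :
  retr (opmul (tens_n S (opadd U U')) M) =
  retr (opmul (tens_n S U) M) + retr (opmul (tens_n S U') M).
Proof.
rewrite /retr -Re_add; congr (Re _); rewrite /optr -big_split; apply: eq_bigr => x _.
rewrite /opmul -big_split; apply: eq_bigr => y _ /=.
by rewrite /tens_n /opadd; ring.
Qed.

Lemma psd_sub (T : finType) (A B : op R T) : psd A -> psd B ->
  (forall v, qf A v <= qf B v) -> psd (opadd B (opopp A)).
Proof.
move=> [hA _] [hB _] le; apply/psdP; split.
  exact: hermitian_add hB (hermitian_opp hA).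
by move=> v; rewrite qf_add qf_opp subr_ge0.
Qed.

Lemma opadd_subK (T : finType) (A B : op R T) : opadd (opadd B (opopp A)) A = B.
Proof.
by apply/funext => x; apply/funext => y; rewrite /opadd /opopp subrK.
Qed.

Lemma retr_tens_le S S' U U' M : psd S -> psd S' -> psd U -> psd U' -> psd M ->
  (forall v, qf S v <= qf S' v) -> (forall v, qf U v <= qf U' v) ->
  retr (opmul (tens_n S U) M) <= retr (opmul (tens_n S' U') M).
Proof.
move=> pS pS' pU pU' pM leS leU.
have pdS := psd_sub pS pS' leS; have pdU := psd_sub pU pU' leU.
apply: (@le_trans _ _ (retr (opmul (tens_n S U') M))).
  rewrite -[U'](opadd_subK U) retr_tens_addr lerDr.
  by apply: retr_mul_psd_ge0 => //; exact: psd_tens_n.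
rewrite -[S'](opadd_subK S) retr_tens_addl lerDr.
by apply: retr_mul_psd_ge0 => //; exact: psd_tens_n.
Qed.

Lemma tens_n_opcompl_expand S U (A : op R (TAB ^^ n)) :
  retr (opmul A (tens_n (opcompl S) (opcompl U))) =
  retr A - retr (opmul A (tens_n S (@opone R _))) - retr (opmul A (tens_n (@opone R _) U))
  + retr (opmul A (tens_n S U)).
Proof.
have -> : retr A = retr (opmul A (tens_n (@opone R (TA ^^ n)) (@opone R (TB ^^ n)))).
  congr (retr _); rewrite -[LHS]opmul1; congr (opmul _ _).
  apply/funext => x; apply/funext => y; rewrite /tens_n /opone -natrM mulnb.
  congr (_%:R); congr nat_of_bool; apply/eqP/andP => [->|] //.
  move=> [/eqP/ffunP h1 /eqP/ffunP h2]; apply/ffunP => i.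
  by move: (h1 i) (h2 i); rewrite !ffunE; case: (x i) (y i) => [? ?] [? ?] /= -> ->.
rewrite /retr -!(Re_add, Re_opp) /optr -!(sumrB, sumrN, big_split) /=; congr (Re _).
apply: eq_bigr => x _; rewrite /opmul -!sumrB -big_split /=; apply: eq_bigr => y _.
by rewrite /tens_n /opcompl /opadd /opopp; ring.
Qed.

Lemma retr_ptrB (rho : op R TAB) (X : op R (TA ^^ n)) :
  retr (opmul (@optpow R TAB n rho) (tens_n X (@opone R (TB ^^ n)))) =
  retr (opmul (@optpow R TA n (ptrB rho)) X).
Proof.
congr (Re _); rewrite /optr /opmul.
pose F (a : TA ^^ n) (b : TB ^^ n) (a' : TA ^^ n) (b' : TB ^^ n) : C :=
  (\prod_i rho (a i, b i) (a' i, b' i)) * (X a' a * (b' == b)%:R).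
transitivity (\sum_a \sum_(b : TB ^^ n) \sum_(a' : TA ^^ n) \sum_(b' : TB ^^ n) F a b a' b').
  rewrite -(@sum_ffun_pair n _ _ _ _ _ (fun a b => \sum_(a' : TA ^^ n) \sum_(b' : TB ^^ n) F a b a' b')).
  apply: eq_bigr => x _.
  rewrite -(@sum_ffun_pair n _ _ _ _ _ (F (fstn x) (sndn x))).
  apply: eq_bigr => y _; rewrite /F /optpow /tens_n /opone; congr (_ * _).
  by apply: eq_bigr => i _; rewrite !ffunE -!surjective_pairing.
apply: eq_bigr => a _; rewrite exchange_big; apply: eq_bigr => a' _ /=.
rewrite /optpow /ptrB (bigA_distr_bigA (fun i b => rho (a i, b) (a' i, b))) mulr_suml.
apply: eq_bigr => b _; rewrite (bigD1 b) //= big1 => [|b' /negbTE bb]; last first.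
  by rewrite /F bb !mulr0.
by rewrite /F eqxx mulr1 addr0.
Qed.

Lemma retr_ptrA (rho : op R TAB) (X : op R (TB ^^ n)) :
  retr (opmul (@optpow R TAB n rho) (tens_n (@opone R (TA ^^ n)) X)) =
  retr (opmul (@optpow R TB n (ptrA rho)) X).
Proof.
congr (Re _); rewrite /optr /opmul.
pose F (a : TA ^^ n) (b : TB ^^ n) (a' : TA ^^ n) (b' : TB ^^ n) : C :=
  (\prod_i rho (a i, b i) (a' i, b' i)) * ((a' == a)%:R * X b' b).
transitivity (\sum_(a : TA ^^ n) \sum_b \sum_(a' : TA ^^ n) \sum_(b' : TB ^^ n) F a b a' b').
  rewrite -(@sum_ffun_pair n _ _ _ _ _ (fun a b => \sum_(a' : TA ^^ n) \sum_(b' : TB ^^ n) F a b a' b')).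
  apply: eq_bigr => x _.
  rewrite -(@sum_ffun_pair n _ _ _ _ _ (F (fstn x) (sndn x))).
  apply: eq_bigr => y _; rewrite /F /optpow /tens_n /opone; congr (_ * _).
  by apply: eq_bigr => i _; rewrite !ffunE -!surjective_pairing.
rewrite exchange_big; apply: eq_bigr => b _ /=.
transitivity (\sum_(a : TA ^^ n) \sum_(b' : TB ^^ n) F a b a b').
  apply: eq_bigr => a _; rewrite (bigD1 a) //= [X in _ + X]big1 ?addr0 // => a' /negbTE aa.
  by rewrite big1 // => b' _; rewrite /F aa mul0r mulr0.
rewrite exchange_big; apply: eq_bigr => b' _ /=.
rewrite /optpow /ptrA (bigA_distr_bigA (fun i a => rho (a, b i) (a, b' i))) mulr_suml.
by apply: eq_bigr => a _; rewrite /F eqxx mul1r.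
Qed.

(** A union bound: (1-S) (x) 1 + 1 (x) (1-U) exceeds 1 - S (x) U by (1-S) (x) (1-U), which is
    positive. *)
Lemma retr_compl_tens_le (rho : op R TAB) S U : density rho ->
  projector S -> projector U ->
  retr (opmul (@optpow R TAB n rho) (opcompl (tens_n S U))) <=
  retr (opmul (@optpow R TA n (ptrB rho)) (opcompl S)) +
  retr (opmul (@optpow R TB n (ptrA rho)) (opcompl U)).
Proof.
move=> dr pS pU; have [pr tr] := density_optpow n dr.
have pSU : psd (tens_n (opcompl S) (opcompl U)).
  by apply: psd_tens_n; apply/psd_projector/projector_compl.
have := retr_mul_psd_ge0 pr pSU; rewrite tens_n_opcompl_expand.
rewrite /opcompl !retr_one_sub retr_ptrB retr_ptrA.
have -> : retr (@optpow R TAB n rho) = 1 by rewrite /retr tr.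
have -> : retr (@optpow R TA n (ptrB rho)) = 1.
  by rewrite /retr (proj2 (density_optpow n (density_ptrB dr))).
have -> : retr (@optpow R TB n (ptrA rho)) = 1.
  by rewrite /retr (proj2 (density_optpow n (density_ptrA dr))).
by lra.
Qed.

End PowerSystems.
End Bipartite.

(** * Compression of a test by projectors dominating all permutation-invariant states *)

Section CompositeTest.
Variable R : realType.
Local Notation C := R[i].
Local Notation "T ^^ n" := {ffun 'I_n -> T} (at level 30).

(** By commutation the cross terms between the range and the kernel of [P] vanish. *)
Lemma qf_conj_commuting_le (T : finType) (A P : op R T) v : psd A -> projector P ->
  commuting A P -> qf A (app P v) <= qf A v.
Proof.
move=> /psdP [hA pA] [hP iP] cAP; rewrite -subr_ge0.
suff -> : qf A v - qf A (app P v) = qf A (v \- app P v) by [].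
rewrite [in RHS]/qf app_subr ip_subr !ip_subl.
have -> : ip v (app A (app P v)) = ip (app P v) (app A (app P v)).
  by rewrite -(ip_appC _ _ hP) -cAP iP.
have -> : ip (app P v) (app A v) = ip (app P v) (app A (app P v)).
  by rewrite -(ip_appC _ _ hP) -cAP -(ip_appC _ _ hP) -cAP iP.
by rewrite subrr subr0 Re_add Re_opp.
Qed.

(** [typical_projector] with the universal operator as [W]. Hence [P] is chosen before the state [s]
    and serves all permutation-invariant states at once. *)
Lemma exists_universal_projector (T : finType) (n : nat) (A : op R T) (t : R) :
  density A -> 0 < t ->
  exists P : op R (T ^^ n), [/\ projector P,
    forall s, sym_state s -> forall v,
      qf (opmul P (opmul s P)) v <= t * qf (@optpow R T n A) v &
    retr (opmul (@optpow R T n A) (opcompl P)) <= (n.+1 ^ (#|T| * #|T|))%:R / t].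
Proof.
move=> dA t0; have [pAn _] := density_optpow n dA.
have cU := commuting_universal (@perm_inv_optpow R T n A).
have [P [pP cP leP trP]] := typical_projector t (proj1 pAn) (psd_universal R n T) cU.
exists P; split=> // [s ss v|].
  rewrite qf_conj; last exact: (proj1 pP).
  apply: le_trans (sym_state_le_universal _ ss) _.
  by apply: le_trans (leP v) _; rewrite ler_pM2l // qf_conj_commuting_le.
by rewrite ler_pdivlMr // mulrC (le_trans trP) // retr_universal_le.
Qed.

Lemma pow_eig_type (T : finType) (n : nat) (m : T -> R) (k : T ^^ n) :
  pow_eig m k = \prod_u m u ^+ type_class k u.
Proof.
rewrite /pow_eig (partition_big (fun i => k i) predT) //=; apply: eq_bigr => u _.
rewrite (eq_bigr (fun=> m u)) => [|i /eqP -> //].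
by rewrite prodr_const type_classE.
Qed.

Variables TA TB : finType.
Local Notation TAB := (TA * TB)%type.

(* The Nussbaum-Szkola probability of {l_i <= x m_j}, for the n-th tensor
   powers of states with spectral data (l, v) and (m, u). *)
Definition NS_cdf (T : finType) (n : nat) (l m : T -> R) (v u : T -> T -> C) (x : R) : R :=
  \sum_(i : T ^^ n) \sum_(j | pow_eig l i <= x * pow_eig m j)
     pow_eig l i * nsq (ip (pow_basis u j) (pow_basis v i)).

(** The parameters: [c] is the likelihood threshold of the test, [K] the slack that pays for
    pinching, [t] the domination constant on each of A^n and B^n (hence t^2 / c), and [h] the weight
    in the compression inequality. *)
Lemma composite_achievability (n : nat) (rho : op R TAB) (l m : TAB -> R)
    (v u : TAB -> TAB -> C) (c K t h : R) :
  density rho -> orthonormal v -> rho = spop l v -> orthonormal u ->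
  optens (ptrB rho) (ptrA rho) = spop m u ->
  (forall k, 0 <= l k) -> \sum_k l k = 1 -> (forall k, 0 <= m k) ->
  0 < c -> 0 < K -> 0 < t -> 0 < h ->
  exists M : op R (TAB ^^ n), [/\ test_op M,
    forall s t', sym_state s -> sym_state t' -> retr (opmul (tens_n s t') M) <= t ^+ 2 / c &
    retr (opmul (@optpow R TAB n rho) (opcompl M)) <=
      (1 + h) * (NS_cdf n l m v u (K * c) + (n.+1 ^ #|{: TAB}|)%:R / K) +
      (2 + h^-1) * ((n.+1 ^ (#|TA| * #|TA|))%:R / t + (n.+1 ^ (#|TB| * #|TB|))%:R / t)].
Proof.
move=> dr ov rE ou sE l0 l1 m0 c0 K0 t0 h0.
pose mu (tau : {ffun TAB -> 'I_n.+1}) := \prod_x m x ^+ tau x.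
have mu0 tau : 0 <= mu tau by apply: prodr_ge0 => x _; rewrite exprn_ge0.
have muE : pow_eig m = mu \o @type_class n TAB.
  by apply/funext => k; rewrite pow_eig_type.
have sum1 : \sum_(k : TAB ^^ n) pow_eig l k = 1 by rewrite sum_pow_eig l1 expr1n.
(* Eigenvalues of the second power depend on the type only, so pinching by types uses polynomially
   many blocks. *)
have [M [tM M1 M2]] := testing_achievability (@type_class n TAB)
  (orthonormal_pow ov) (orthonormal_pow ou) (pow_eig_ge0 l0) sum1 mu0 c0 K0.
have [P [pP P1 P2]] := exists_universal_projector n (density_ptrB dr) t0.
have [Q [pQ Q1 Q2]] := exists_universal_projector n (density_ptrA dr) t0.
have pPQ := projector_tens_n pP pQ.
exists (opmul (tens_n P Q) (opmul M (tens_n P Q))); split.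
- exact: test_sandwich.
- move=> s s' ss ss'.
  (* Cyclicity moves the compression from the test onto the two states, where the domination by [t]
     applies. *)
  have -> : retr (opmul (tens_n s s') (opmul (tens_n P Q) (opmul M (tens_n P Q)))) =
    retr (opmul (tens_n (opmul P (opmul s P)) (opmul Q (opmul s' Q))) M).
    by rewrite -!tens_n_mul !opmulA [LHS](retr_mulC _ (tens_n P Q)) !opmulA.
  have pAn := proj1 (density_optpow n (density_ptrB dr)).
  have pBn := proj1 (density_optpow n (density_ptrA dr)).
  have psc (T : finType) (A : op R T) : psd A -> psd (opscale (real_complex R t) A).
    move=> /psdP [hA pA]; apply/psdP; split=> [|w]; first exact: hermitian_scale.
    by rewrite qf_scale mulr_ge0 // ltW.
  have pcj (T : finType) (A P' : op R T) : psd A -> projector P' -> psd (opmul P' (opmul A P')).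
    move=> /psdP [hA pA] [hP' _]; apply/psdP; split=> [|w]; first exact: hermitian_conj.
    by rewrite qf_conj.
  have pM : psd M by case: tM.
  have := retr_tens_le (pcj _ _ _ (proj1 (proj1 ss)) pP) (psc _ _ pAn)
     (pcj _ _ _ (proj1 (proj1 ss')) pQ) (psc _ _ pBn) pM.
  move=> /(_ _ _)/le_trans; apply; [by move=> w; rewrite qf_scale P1|by move=> w; rewrite qf_scale Q1|].
  have -> : tens_n (opscale (real_complex R t) (@optpow R TA n (ptrB rho)))
                   (opscale (real_complex R t) (@optpow R TB n (ptrA rho))) =
            opscale (real_complex R (t ^+ 2)) (@optpow R TAB n (optens (ptrB rho) (ptrA rho))).
    rewrite -tens_n_optpow; apply/funext => x; apply/funext => y.
    by rewrite /tens_n /opscale expr2 realCM; ring.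
  have -> : retr (opmul (opscale (real_complex R (t ^+ 2)) (@optpow R TAB n (optens (ptrB rho) (ptrA rho)))) M) =
     t ^+ 2 * retr (opmul (@optpow R TAB n (optens (ptrB rho) (ptrA rho))) M).
    rewrite /retr -Re_scale; congr (complex.Re _); rewrite /optr mulr_sumr.
    apply: eq_bigr => x _; rewrite /opmul mulr_sumr; apply: eq_bigr => y _.
    by rewrite /opscale mulrA.
  rewrite ler_pM2l ?exprn_gt0 // sE optpow_spop muE.
  by rewrite -[leRHS]mul1r ler_pdivlMr // mulrC.
- have le1 : retr (opmul (@optpow R TAB n rho) (opcompl M)) <=
     NS_cdf n l m v u (K * c) + (n.+1 ^ #|{: TAB}|)%:R / K.
    rewrite {1}rE optpow_spop (le_trans M2) // card_ffun card_ord lerD2r.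
    rewrite /NS_cdf; apply: ler_sum => i _.
    by rewrite muE.
  have le2 := le_trans (retr_compl_tens_le dr pP pQ) (lerD P2 Q2).
  apply: le_trans (_ : _ <= (1 + h) * retr (opmul (@optpow R TAB n rho) (opcompl M)) +
    (2 + h^-1) * retr (opmul (@optpow R TAB n rho) (opcompl (tens_n P Q)))) _.
    rewrite rE optpow_spop !retr_spop_mul !mulr_sumr -big_split; apply: ler_sum => k _ /=.
    rewrite [X in _ <= X + _]mulrCA [X in _ <= _ + X]mulrCA -mulrDr.
    by rewrite ler_wpM2l ?pow_eig_ge0 // qf_compl_sandwich_le.
  by rewrite lerD // ler_pM2l // addr_gt0 // invr_gt0.
Qed.

End CompositeTest.

(** * Stein's method for sums of independent variables *)

Section IidSums.
Variables (R : realType) (J : finType) (p x : J -> R).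

(* Expectation of g (X_1 + ... + X_n) for X_i iid taking the value x j with
   probability p j. *)
Fixpoint Esum (n : nat) (g : R -> R) : R :=
  if n is n'.+1 then \sum_j p j * Esum n' (fun s => g (s + x j)) else g 0.

Lemma eq_Esum n g h : g =1 h -> Esum n g = Esum n h.
Proof. by move=> /funext ->. Qed.

Lemma EsumD n g h : Esum n (fun s => g s + h s) = Esum n g + Esum n h.
Proof.
elim: n g h => [//|n IH] g h /=; rewrite -big_split; apply: eq_bigr => j _ /=.
by rewrite -mulrDr -IH.
Qed.

Lemma EsumZ n c g : Esum n (fun s => c * g s) = c * Esum n g.
Proof.
elim: n g => [//|n IH] g /=; rewrite mulr_sumr; apply: eq_bigr => j _.
by rewrite IH mulrCA.
Qed.

Lemma EsumB n g h : Esum n (fun s => g s - h s) = Esum n g - Esum n h.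
Proof.
rewrite (_ : (fun s => g s - h s) = fun s => g s + (-1) * h s).
  by rewrite EsumD EsumZ mulN1r.
by apply/funext => s; rewrite mulN1r.
Qed.

Lemma Esum_ffun n g : Esum n g =
  \sum_(k : {ffun 'I_n -> J}) (\prod_i p (k i)) * g (\sum_i x (k i)).
Proof.
elim: n g => [|n IH] g.
  have k0 (k : {ffun 'I_0 -> J}) : (\prod_i p (k i)) * g (\sum_i x (k i)) = g 0.
    by rewrite !big_ord0 mul1r.
  rewrite (eq_bigr _ (fun k _ => k0 k)) sumr_const card_ffun card_ord expn0.
  by rewrite mulr1n.
rewrite [LHS]/=; under eq_bigr do rewrite IH mulr_sumr.
rewrite pair_bigA /=.
pose h (jk : J * {ffun 'I_n -> J}) : {ffun 'I_n.+1 -> J} :=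
  [ffun i => oapp jk.2 jk.1 (unlift ord0 i)].
rewrite [RHS](reindex h) /=; last first.
  apply: onW_bij; exists (fun z : {ffun 'I_n.+1 -> J} =>
      (z ord0, [ffun i : 'I_n => z (lift ord0 i)])).
    case=> j k; rewrite /h /=; congr pair; first by rewrite ffunE unlift_none.
    by apply/ffunP => i; rewrite !ffunE liftK.
  move=> z; apply/ffunP => i; rewrite ffunE /=.
  by case: unliftP => [i'|] ->; rewrite /= ?ffunE.
apply: eq_bigr => -[j k] _; rewrite !big_ord_recl /= !ffunE unlift_none /= mulrA addrC.
congr (_ * _ * g (_ + _)).
  by apply: eq_bigr => i _; rewrite ffunE liftK.
by apply: eq_bigr => i _; rewrite ffunE liftK.
Qed.

Hypothesis p0 : forall j, 0 <= p j.
Hypothesis p1 : \sum_j p j = 1.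

Lemma ler_Esum n g h : (forall s, g s <= h s) -> Esum n g <= Esum n h.
Proof.
elim: n g h => [|n IH] g h le //=; apply: ler_sum => j _.
by rewrite ler_wpM2l // IH.
Qed.

Lemma Esum_cst n c : Esum n (fun=> c) = c.
Proof. by elim: n => [//|n IH] /=; rewrite IH -mulr_suml p1 mul1r. Qed.

Lemma Esum_norm_le n g c : (forall s, `|g s| <= c) -> `|Esum n g| <= c.
Proof.
move=> le; rewrite ler_norml -{1}(Esum_cst n (- c)) -{2}(Esum_cst n c).
by apply/andP; split; apply: ler_Esum => s; have := le s; rewrite ler_norml => /andP[].
Qed.

(** By exchangeability each of the n+1 summands contributes equally. The right-hand side isolates
    one summand from an independent sum of the others, as Stein's method requires. *)
Lemma Esum_mul_sum n g : Esum n.+1 (fun s => s * g s) =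
  n.+1%:R * \sum_j p j * x j * Esum n (fun s => g (s + x j)).
Proof.
elim: n g => [|n IH] g.
  by rewrite /= mul1r; apply: eq_bigr => j _; rewrite add0r mulrA.
have -> : Esum n.+2 (fun s => s * g s) = \sum_j p j *
    (Esum n.+1 (fun s => s * g (s + x j)) + x j * Esum n.+1 (fun s => g (s + x j))).
  transitivity (\sum_j p j * Esum n.+1 (fun s => (s + x j) * g (s + x j))); first by [].
  apply: eq_bigr => j _; rewrite -[x j * _]EsumZ -EsumD; congr (p j * _).
  by apply: eq_Esum => s; rewrite mulrDl.
under eq_bigr do rewrite mulrDr IH.
rewrite big_split /= -[n.+2%:R]natr1 mulrDl mul1r; congr (_ + _); last first.
  by apply: eq_bigr => j _; rewrite mulrA.
rewrite mulr_sumr; under eq_bigr do rewrite mulrCA mulr_sumr mulr_sumr.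
rewrite exchange_big; apply: eq_bigr => i _ /=.
rewrite mulr_sumr mulr_sumr; apply: eq_bigr => j _.
rewrite (@eq_Esum n _ (fun s => g (s + x j + x i))); last by move=> s; rewrite addrAC.
ring.
Qed.

Hypothesis mean0 : \sum_j p j * x j = 0.
Variable V : R.
Hypothesis varE : \sum_j p j * x j ^+ 2 = V.

Lemma Esum_sqr n : Esum n (fun s => s ^+ 2) = n%:R * V.
Proof.
case: n => [|n]; first by rewrite /= expr0n mul0r.
rewrite (@eq_Esum n.+1 _ (fun s => s * s)); last by move=> s; rewrite expr2.
rewrite (Esum_mul_sum n id) -varE; congr (_ * _).
have Es : Esum n id = 0.
  elim: n => [//|n IH] /=; transitivity (\sum_j p j * x j); last exact: mean0.
  by apply: eq_bigr => j _; rewrite EsumD IH Esum_cst add0r.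
by apply: eq_bigr => j _; rewrite EsumD Es Esum_cst add0r expr2 mulrA.
Qed.

(** The mean value theorem with the modulus of continuity of [f']; no second derivative enters,
    since the Stein solutions used later inherit kinks in [f'] from ramps. *)
Lemma taylor1_le (f f' : R -> R) (d e : R) :
  (forall w, is_derive w (1 : R) f (f' w)) ->
  (forall w h, `|h| < d -> `|f' (w + h) - f' w| <= e) ->
  forall w h, `|h| < d -> `|f (w + h) - f w - h * f' w| <= `|h| * e.
Proof.
move=> df uf w h hd.
have cf : continuous f.
  by move=> y; apply/differentiable_continuous/derivable1_diffP; have := df y; case.
have [h0|h0|->] := ltgtP h 0; last by rewrite addr0 subrr mul0r subr0 normr0 mul0r.
- have wh : w + h < w by rewrite gtrDl.
  have [c + E] := MVT wh (fun y _ => df y) (continuous_subspaceT cf).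
  rewrite in_itv /= => /andP[c1 c2].
  have -> : f (w + h) - f w - h * f' w = h * (f' (w + (c - w)) - f' w).
    by rewrite addrCA subrr addr0; move: E; lra.
  rewrite normrM ler_wpM2l //; apply: uf.
  by move: hd; rewrite !ltr_norml => /andP[? ?]; apply/andP; split; lra.
- have wh : w < w + h by rewrite ltrDl.
  have [c + E] := MVT wh (fun y _ => df y) (continuous_subspaceT cf).
  rewrite in_itv /= => /andP[c1 c2].
  have -> : f (w + h) - f w - h * f' w = h * (f' (w + (c - w)) - f' w).
    by rewrite E addrCA subrr addr0; lra.
  rewrite normrM ler_wpM2l //; apply: uf.
  by move: hd; rewrite !ltr_norml => /andP[? ?]; apply/andP; split; lra.
Qed.

(** Both terms are compared with D, the expectation of [f'] with one summand left out. For the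
    first, Taylor expansion in the isolated summand is used: the order-zero term dies by [mean0],
    the order-one term equals D by [varE] and the choice of [a]. *)
Lemma stein_bound (f f' : R -> R) (a d e : R) (n : nat) :
  (forall w, is_derive w (1 : R) f (f' w)) ->
  (forall w h, `|h| < d -> `|f' (w + h) - f' w| <= e) ->
  0 < a -> a ^+ 2 * n.+1%:R * V = 1 -> (forall j, `|a * x j| < d) ->
  `|Esum n.+1 (fun s => a * s * f (a * s) - f' (a * s))| <= 2 * e.
Proof.
move=> df uf a0 aV xd; rewrite EsumB.
have e0 : 0 <= e.
  have [j _|noJ] := pickP (@predT J); last first.
    by move: p1; rewrite big_pred0 // => /eqP; rewrite eq_sym oner_eq0.
  by apply: le_trans (uf 0 (a * x j) (xd j)).
pose D := Esum n (fun s => f' (a * s)).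
have step1 : `|Esum n.+1 (fun s => f' (a * s)) - D| <= e.
  have -> : Esum n.+1 (fun s => f' (a * s)) - D =
      \sum_j p j * Esum n (fun s => f' (a * s + a * x j) - f' (a * s)).
    rewrite /= -[D]mul1r -p1 mulr_suml -sumrB; apply: eq_bigr => j _.
    rewrite -mulrBr EsumB; congr (_ * (_ - _)).
    by apply: eq_Esum => s; rewrite mulrDr.
  rewrite (le_trans (ler_norm_sum _ _ _)) // -[leRHS]mul1r -p1 mulr_suml.
  apply: ler_sum => j _; rewrite normrM ger0_norm // ler_wpM2l //.
  by apply: Esum_norm_le => s; apply: uf.
have step2 : `|Esum n.+1 (fun s => a * s * f (a * s)) - D| <= e.
  have -> : Esum n.+1 (fun s => a * s * f (a * s)) - D = a * n.+1%:R *
     \sum_j p j * x j * Esum n (fun s => f (a * s + a * x j) - f (a * s) - a * x j * f' (a * s)).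
    have -> : Esum n.+1 (fun s => a * s * f (a * s)) = a * Esum n.+1 (fun s => s * f (a * s)).
      by rewrite -EsumZ; apply: eq_Esum => s; rewrite mulrA.
    rewrite Esum_mul_sum mulrA.
    have -> : D = a * n.+1%:R * \sum_j p j * x j * (Esum n (fun s => f (a * s)) + a * x j * D).
      have -> : \sum_j p j * x j * (Esum n (fun s => f (a * s)) + a * x j * D) =
        (\sum_j p j * x j) * Esum n (fun s => f (a * s)) + a * D * \sum_j p j * x j ^+ 2.
        by rewrite mulr_suml mulr_sumr -big_split; apply: eq_bigr => j _ /=; ring.
      rewrite mean0 mul0r add0r varE -[LHS]mul1r -[in LHS]aV; ring.
    rewrite -mulrBr -sumrB; congr (_ * _); apply: eq_bigr => j _.
    rewrite -mulrBr !EsumB EsumZ -/D; congr (_ * _).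
    rewrite opprD addrA; congr (_ - _ - _).
    by apply: eq_Esum => s; rewrite mulrDr.
  rewrite normrM ger0_norm ?mulr_ge0 ?(ltW a0) //.
  apply: (@le_trans _ _ (a * n.+1%:R * \sum_j (p j * `|x j| * (`|a * x j| * e)))).
    rewrite ler_wpM2l ?mulr_ge0 ?(ltW a0) // (le_trans (ler_norm_sum _ _ _)) //.
    apply: ler_sum => j _; rewrite !normrM (ger0_norm (p0 j)) ler_wpM2l ?mulr_ge0 //.
    rewrite -normrM; apply: Esum_norm_le => s.
    exact: taylor1_le df uf _ _ (xd j).
  have -> : \sum_j (p j * `|x j| * (`|a * x j| * e)) = a * e * V.
    rewrite -varE mulr_sumr; apply: eq_bigr => j _.
    by rewrite normrM (gtr0_norm a0) -[x j ^+ 2]real_normK ?num_real //; ring.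
  have -> : a * n.+1%:R * (a * e * V) = (a ^+ 2 * n.+1%:R * V) * e by ring.
  by rewrite aV mul1r.
have -> : Esum n.+1 (fun s => a * s * f (a * s)) - Esum n.+1 (fun s => f' (a * s)) =
  (Esum n.+1 (fun s => a * s * f (a * s)) - D) - (Esum n.+1 (fun s => f' (a * s)) - D) by lra.
by rewrite (le_trans (ler_normB _ _)) // mulr_natl mulr2n lerD.
Qed.

End IidSums.

(** * Uniform continuity, and derivatives of formulas with absolute values *)

Section Calculus.
Variable R : realType.

Lemma uniform_continuity_compact_support (g : R -> R) (M : R) : continuous g ->
  (forall w, M <= `|w| -> g w = 0) ->
  forall e, 0 < e -> exists2 d, 0 < d & forall w h, `|h| < d -> `|g (w + h) - g w| <= e.
Proof.
move=> cg g0 e e0.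
have cK : compact `[- (M + 1), M + 1]%classic by apply: segment_compact.
move/compact_near_coveringP : cK => /(_ R (0 : R)^'+
  (fun d w => forall h, `|h| < d -> `|g (w + h) - g w| <= e) _) H.
have : \forall d \near 0^'+, `[- (M + 1), M + 1]%classic `<=`
    (fun w => forall h, `|h| < d -> `|g (w + h) - g w| <= e).
  apply: H => w _.
  have /cvgrPdist_lt /(_ (e / 2)) := cg w; rewrite divr_gt0 // => /(_ isT).
  move=> /nbhs_ballP [d /= d0 hd].
  exists (ball w (d / 2), [set t | 0 < t < d / 2]) => /=.
    split; first by apply: nbhsx_ballx; rewrite divr_gt0.
    near=> t => /=; apply/andP; split; first by near: t; exact: nbhs_right_gt.
    by near: t; apply: nbhs_right_lt; rewrite divr_gt0.
  move=> [w' t] /= [bw /andP[t0 td]] h ht.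
  have h1 : `|g w - g w'| < e / 2.
    by apply: hd; apply: le_ball bw; rewrite ler_pdivrMr // ler_peMr ?ler1n // ltW.
  have h2 : `|g w - g (w' + h)| < e / 2.
    apply: hd; rewrite /ball /= in bw *.
    rewrite opprD addrA (le_lt_trans (ler_normB _ _)) // [ltRHS]splitr ltrD //.
    exact: lt_trans ht td.
  have -> : g (w' + h) - g w' = (g w - g w') - (g w - g (w' + h)) by lra.
  by rewrite (le_trans (ler_normB _ _)) // [leRHS]splitr lerD // ltW.
move=> Hn; near (0 : R)^'+ => d.
have dH : `[- (M + 1), M + 1]%classic `<=`
    (fun w => forall h, `|h| < d -> `|g (w + h) - g w| <= e) by near: d.
have d0 : 0 < d by near: d; exact: nbhs_right_gt.
(* With |h| < 1, a point beyond M + 1 stays beyond M after the shift, so both values of [g]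
   vanish. *)
have d1 : d < 1 by near: d; exact: nbhs_right_lt.
exists d => // w h hd; have [wM|wM] := leP `|w| (M + 1).
  by apply: dH => //=; rewrite in_itv /= -ler_norml.
have := lerB_normD w h; move=> tr.
by rewrite !g0 ?subrr ?normr0 ?(ltW e0) //; lra.
Unshelve. all: by end_near. Qed.

(** A quadratic remainder bound can be checked by cases on signs, which suits formulas with absolute
    values. *)
Lemma is_derive_quadratic (f : R -> R) (y D C : R) :
  (forall h, `|f (y + h) - f y - h * D| <= C * h ^+ 2) -> is_derive y (1 : R) f D.
Proof.
move=> le.
have cv : (fun h : R => h^-1 *: (f (h *: (1 : R) + y) - f y)) @ 0^' --> D.
  apply/cvgrPdist_le => e e0.
  have C1 : 0 < `|C| + 1 by rewrite ltr_wpDl.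
  near=> h.
  have h0 : h != 0 by near: h; exact: nbhs_dnbhs_neq.
  have hs : `|h| <= e / (`|C| + 1).
    near: h; apply: dnbhs0_le; exact: divr_gt0.
  have -> : D - h^-1 *: (f (h *: (1 : R) + y) - f y) = - (f (y + h) - f y - h * D) / h.
    rewrite /GRing.scale /= mulr1 [h + y]addrC; field; exact: h0.
  rewrite normrM normrN normfV ler_pdivrMr ?normr_gt0 //.
  apply: (le_trans (le h)); rewrite -[h ^+ 2]real_normK ?num_real // expr2 mulrA.
  rewrite ler_wpM2r //; apply: (@le_trans _ _ ((`|C| + 1) * `|h|)).
    by rewrite ler_wpM2r // ler_wpDr // ler_norm.
  by rewrite mulrC -ler_pdivlMr.
apply: DeriveDef; first by apply/cvg_ex; exists D.
exact/cvg_lim.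
Unshelve. all: by end_near. Qed.

Definition pospart (y : R) := (y + `|y|) / 2.

(** The function is half the square of the positive part. *)
Lemma is_derive_pospart2 (y : R) :
  is_derive y (1 : R) (fun z => z * (z + `|z|) / 4) (pospart y).
Proof.
apply: (@is_derive_quadratic _ _ _ 1) => h; rewrite mul1r /pospart.
rewrite ler_norml; apply/andP; split.
  have [] := ger0P y; have [] := ger0P (y + h); move=> h1 h2; nra.
have [] := ger0P y; have [] := ger0P (y + h); move=> h1 h2; nra.
Qed.

Lemma continuous_pospart : continuous pospart.
Proof.
move=> y; apply: cvgMl; apply: cvgD; first exact: cvg_id.
exact: norm_continuous.
Qed.

End Calculus.

(** * The central limit theorem *)

Section StandardNormal.
Variable R : realType.
Local Notation mu := (@lebesgue_measure R).

Definition gaussd (t : R) : R := expR (- t ^+ 2 / 2).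

Lemma normal_pdf01E (t : R) : normal_pdf 0 1 t = normal_peak 1 * gaussd t.
Proof.
rewrite normal_pdfE ?oner_neq0 // /normal_fun subr0 expr1n.
by rewrite /gaussd.
Qed.

Lemma integrable_gaussd : mu.-integrable setT (EFin \o gaussd).
Proof.
have h : (EFin \o gaussd) = (fun t => (normal_peak (1 : R))^-1%:E * (normal_pdf 0 1 t)%:E)%E.
  apply/funext => t /=; rewrite -EFinM normal_pdf01E mulKf //.
  by rewrite gt_eqF // normal_peak_gt0 // oner_neq0.
by rewrite h; apply: integrableZl => //; exact: integrable_normal_pdf.
Qed.

Lemma integrable_gaussd_Ny (x : R) : mu.-integrable `]-oo, x] (EFin \o gaussd).
Proof. exact: (integrableS _ _ (@subsetT _ _) integrable_gaussd). Qed.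

Lemma normal_peak1 : normal_peak 1 = (Num.sqrt (2 * pi))^-1 :> R.
Proof. by rewrite /normal_peak expr1n mul1r mulr_natl. Qed.

Lemma Phi_normal_prob (x : R) : Phi x = fine (normal_prob 0 1 `]-oo, x]).
Proof.
rewrite /normal_prob.
under eq_integral do rewrite normal_pdf01E EFinM.
rewrite integralZl //=; last exact: integrable_gaussd_Ny.
rewrite fineM //; last exact: integrable_fin_num (integrable_gaussd_Ny x).
by rewrite /= normal_peak1 mulrC.
Qed.

(** The identity as a random variable under the normal law: its distribution function is [Phi],
    which gives the limits at both infinities. *)
Let idTR : measurableTypeR R -> R := idfun.

#[local] HB.instance Definition _ :=
  @isMeasurableFun.Build _ _ _ _ idTR (@measurable_id _ _ setT).

Let PhiE : @Phi R = fun x => fine (cdf (idTR : {RV (normal_prob 0 1) >-> R}) x).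
Proof. by apply/funext => x; rewrite Phi_normal_prob. Qed.

Lemma Phi_cvgNy : @Phi R @ -oo --> (0 : R).
Proof. by rewrite PhiE; exact/fine_cvg/cvg_cdfNy0. Qed.

Lemma Phi_cvgy : @Phi R @ +oo --> (1 : R).
Proof. by rewrite PhiE; exact/fine_cvg/cvg_cdfy1. Qed.

Lemma is_derive_Phi (x : R) : is_derive x (1 : R) (@Phi R) (gaussd x / Num.sqrt (2 * pi)).
Proof.
have cg : continuous gaussd.
  move=> y; apply: continuous_comp; last exact: continuous_expR.
  apply: cvgMl; apply: cvgN; exact: exprn_continuous.
have xx : x < x + 1 by rewrite ltrDl.
have [dF F'] := continuous_FTC1 xx (integrable_gaussd_Ny (x + 1)) (ltNyr x) (cg x).
pose F (y : R) := (\int[mu]_(t in `]-oo, y]) gaussd t)%R.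
have dF1 : is_derive x (1 : R) F (gaussd x).
  by apply: DeriveDef; [exact: dF|rewrite -derive1E].
have -> : @Phi R = fun y => F y * (Num.sqrt (2 * pi))^-1 by [].
have := @is_deriveM R R F (cst (Num.sqrt (2 * pi))^-1) x 1 _ _ dF1 (is_derive_cst _ _ _).
move=> H; apply: (@is_derive_eq _ _ _ _ _ _ _ _ H).
by rewrite /GRing.scale /= mulr0 add0r mulrC.
Qed.

Lemma gaussd_gt0 (t : R) : 0 < gaussd t. Proof. exact: expR_gt0. Qed.

Lemma sqrt2pi_gt0 : 0 < Num.sqrt (2 * pi) :> R.
Proof. by rewrite sqrtr_gt0 mulr_gt0 // pi_gt0. Qed.

Lemma Phi_continuous : continuous (@Phi R).
Proof.
move=> y; apply/differentiable_continuous/derivable1_diffP.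
by have := is_derive_Phi y; case.
Qed.

Lemma Phi_lt (x y : R) : x < y -> Phi x < Phi y.
Proof.
move=> xy; have [c _ E] := MVT xy (fun z _ => is_derive_Phi z) (continuous_subspaceT Phi_continuous).
by rewrite -subr_gt0 E mulr_gt0 ?subr_gt0 // divr_gt0 ?gaussd_gt0 ?sqrt2pi_gt0.
Qed.

Lemma Phi_le (x y : R) : x <= y -> Phi x <= Phi y.
Proof. by rewrite le_eqVlt => /orP[/eqP ->//|/Phi_lt/ltW]. Qed.

Lemma Phi_lt_cancel (x y : R) : Phi x < Phi y -> x < y.
Proof. by move=> h; rewrite ltNge; apply: contraTN h => /Phi_le; rewrite -leNgt. Qed.

Lemma Phi_gt0_lt1 (x : R) : 0 < Phi x < 1.
Proof.
have ge0 (y : R) : 0 <= Phi y by rewrite PhiE fine_ge0 // cdf_ge0.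
have le1 (y : R) : Phi y <= 1.
  rewrite PhiE -[leRHS]/(fine 1%E); apply: fine_le => //; last exact: cdf_le1.
  exact: fin_num_measure.
have x1 : x - 1 < x by rewrite gtrBl.
have x2 : x < x + 1 by rewrite ltrDl.
by rewrite (le_lt_trans (ge0 _) (Phi_lt x1)) (lt_le_trans (Phi_lt x2) (le1 _)).
Qed.

End StandardNormal.

Section CentralLimit.
Variable R : realType.

(** This turns support inside (0, 1) in the variable Phi w into compact support in w. *)
Lemma exists_Phi_window (al be : R) : 0 < al -> be < 1 ->
  exists M : R, forall w : R, M <= `|w| -> Phi w <= al \/ be <= Phi w.
Proof.
move=> al0 be1.
have [M1 [_ h1]] : \forall w \near -oo, Phi (w : R) < al.
  by have /cvgrPdist_lt /(_ al al0) := @Phi_cvgNy R; apply: filterS => w; rewrite sub0r normrN => /(le_lt_trans (ler_norm _)).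
have [M2 [_ h2]] : \forall w \near +oo, be < Phi (w : R).
  have b0 : 0 < 1 - be by rewrite subr_gt0.
  have /cvgrPdist_lt /(_ _ b0) := @Phi_cvgy R; apply: filterS => w /(le_lt_trans (ler_norm _)); lra.
exists (`|M1| + `|M2| + 1) => w; have [w0|w0] := leP 0 w.
  rewrite (ger0_norm w0) => wM; right; apply/ltW/h2.
  by have := ler_norm M2; have := normr_ge0 M1; lra.
rewrite (ltr0_norm w0) => wM; left; apply/ltW/h1.
have := ler_norm (- M1); rewrite normrN; have := normr_ge0 M2; lra.
Qed.

Variables (J : finType) (p x : J -> R) (V : R).
Hypothesis p0 : forall j, 0 <= p j.
Hypothesis p1 : \sum_j p j = 1.
Hypothesis mean0 : \sum_j p j * x j = 0.
Hypothesis varE : \sum_j p j * x j ^+ 2 = V.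
Hypothesis V0 : 0 < V.
Local Notation E := (Esum p x).
Local Notation scaled n s := (s / Num.sqrt (n%:R * V)).

(** Finitely many values are uniformly bounded, here by the sum of their absolute values; this plays
    the part of a Lindeberg condition. *)
Lemma scale_small (d : R) : 0 < d ->
  \forall n \near \oo, forall j, `|(Num.sqrt (n%:R * V))^-1 * x j| < d.
Proof.
move=> d0; pose X := \sum_j `|x j|.
near=> n => j.
have n0 : X ^+ 2 / (d ^+ 2 * V) < n%:R by near: n; exact: nbhs_infty_gtr.
have nV : 0 < n%:R * V :> R.
  rewrite mulr_gt0 //; apply: le_lt_trans n0; rewrite divr_ge0 ?sqr_ge0 //.
  by rewrite mulr_ge0 ?sqr_ge0 // ltW.
have s0 : 0 < Num.sqrt (n%:R * V) by rewrite sqrtr_gt0.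
rewrite normrM normfV (gtr0_norm s0) mulrC ltr_pdivrMr //.
have xX : `|x j| <= X by rewrite /X (bigD1 j) //= lerDl sumr_ge0.
apply: le_lt_trans xX _.
have X0 : 0 <= X by apply: sumr_ge0.
have h : X ^+ 2 < (d * Num.sqrt (n%:R * V)) ^+ 2.
  rewrite exprMn sqr_sqrtr ?(ltW nV) //; move: n0.
  by rewrite ltr_pdivrMr ?mulr_gt0 ?exprn_gt0 // mulrCA.
have ds : 0 <= d * Num.sqrt (n%:R * V) by rewrite mulr_ge0 // ltW.
by move: h; rewrite ltr_pXn2r ?nnegrE.
Unshelve. all: by end_near. Qed.

(* Stein's method: f w := e^{w^2/2} K (Phi w) has compact support and satisfies
   f' w - w f w = k (Phi w) / sqrt (2 pi). *)
Lemma stein_limit (K k : R -> R) (al be : R) : 0 < al -> be < 1 ->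
  (forall u, is_derive u (1 : R) K (k u)) -> continuous k ->
  (forall u, u <= al \/ be <= u -> K u = 0 /\ k u = 0) ->
  forall e, 0 < e -> \forall n \near \oo,
    `|E n (fun s => k (Phi (scaled n s)))| <= e.
Proof.
move=> al0 be1 dK ck K0 e e0.
pose s2 : R := Num.sqrt (2 * pi); have s20 : 0 < s2 := sqrt2pi_gt0 R.
pose f w := expR (w ^+ 2 / 2) * K (Phi w).
pose f' w := w * f w + k (Phi w) / s2.
have df w : is_derive w (1 : R) f (f' w).
  have d1 : is_derive w (1 : R) (fun z => z ^+ 2 / 2) w.
    apply: (@is_derive_quadratic _ _ _ _ (2^-1)) => h.
    have -> : (w + h) ^+ 2 / 2 - w ^+ 2 / 2 - h * w = 2^-1 * h ^+ 2 by field.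
    by rewrite ger0_norm // mulr_ge0 ?sqr_ge0 // invr_ge0.
  have d2 := @is_derive1_comp R expR (fun z => z ^+ 2 / 2) w _ _ (is_derive_expR (w ^+ 2 / 2)) d1.
  have d3 := @is_derive1_comp R K (@Phi R) w _ _ (dK (Phi w)) (is_derive_Phi w).
  have d4 := is_deriveM d2 d3.
  apply: (@is_derive_eq _ _ _ _ _ _ _ _ d4).
  rewrite /GRing.scale /= /f' /f /gaussd -/s2.
  have EE : expR (w ^+ 2 / 2) * expR (- w ^+ 2 / 2) = 1.
    by rewrite -expRD mulNr subrr expR0.
  have -> : expR (w ^+ 2 / 2) * (k (Phi w) * (expR (- w ^+ 2 / 2) / s2)) =
    (expR (w ^+ 2 / 2) * expR (- w ^+ 2 / 2)) * (k (Phi w) / s2) by ring.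
  by rewrite EE; ring.
have cf : continuous f.
  by move=> y; apply/differentiable_continuous/derivable1_diffP; have := df y; case.
have cf' : continuous f'.
  move=> w; apply: cvgD; first by apply: cvgM; [exact: cvg_id|exact: cf].
  apply: cvgMl; apply: continuous_comp; [exact: Phi_continuous|exact: ck].
have [M hM] := exists_Phi_window al0 be1.
have f'0 w : M <= `|w| -> f' w = 0.
  by move=> /hM /K0 [h1 h2]; rewrite /f' /f h1 h2 !(mulr0, mul0r) addr0.
(* [stein_bound] doubles this constant and the Stein equation carries a factor 1 / s2, so [e]
   remains. *)
have e1 : 0 < e / (2 * s2) by rewrite divr_gt0 // mulr_gt0.
have [d d0 uf] := uniform_continuity_compact_support cf' f'0 e1.
have sm := scale_small d0.
near=> n; suff key n' : (0 < n')%N -> (forall j, `|(Num.sqrt (n'%:R * V))^-1 * x j| < d) ->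
    `|E n' (fun s => k (Phi (scaled n' s)))| <= e.
  by apply: key; near: n; [exact: nbhs_infty_gt|exact: sm].
case: n' => // n' _ smn.
have nV : 0 < n'.+1%:R * V :> R by rewrite mulr_gt0.
set a := (Num.sqrt (n'.+1%:R * V))^-1 in smn.
have a0 : 0 < a by rewrite invr_gt0 sqrtr_gt0.
have aV : a ^+ 2 * n'.+1%:R * V = 1.
  by rewrite -mulrA exprVn sqr_sqrtr ?ltW // mulVf // gt_eqF.
have := stein_bound p0 p1 mean0 varE df uf a0 aV smn.
have -> : E n'.+1 (fun s => a * s * f (a * s) - f' (a * s)) =
  - s2^-1 * E n'.+1 (fun s => k (Phi (scaled n'.+1 s))).
  rewrite -EsumZ; apply: eq_Esum => s; rewrite /f' -/a [s * a]mulrC; ring.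
rewrite normrM normrN (gtr0_norm (_ : 0 < s2^-1)) ?invr_gt0 // mulrC ler_pdivrMr //.
move=> h; apply: (le_trans h); rewrite le_eqVlt; apply/orP; left; apply/eqP.
by field; rewrite gt_eqF.
Unshelve. all: by end_near. Qed.

(** The continuous step rising linearly from 0 at c to 1 at c + e; [Ramp] is its antiderivative
    vanishing to the left of c. *)
Definition ramp (e c u : R) : R := (pospart (u - c) - pospart (u - c - e)) / e.
Definition Ramp (e c u : R) : R :=
  ((u - c) * (u - c + `|u - c|) / 4 - (u - c - e) * (u - c - e + `|u - c - e|) / 4) / e.

Lemma is_derive_Ramp e c u : is_derive u (1 : R) (Ramp e c) (ramp e c u).
Proof.
have sh (b : R) : is_derive u (1 : R) (fun z => (z - b) * (z - b + `|z - b|) / 4) (pospart (u - b)).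
  have d1 : is_derive u (1 : R) (fun z : R => z - b) 1.
    by apply: (@is_derive_quadratic _ _ _ _ 0) => h; rewrite mul0r; rewrite normr_le0; apply/eqP; lra.
  have := @is_derive1_comp R (fun z => z * (z + `|z|) / 4) (fun z => z - b) u _ _
    (is_derive_pospart2 (u - b)) d1.
  by rewrite mulr1.
have d2 := sh c; have d3 := sh (c + e).
have := is_deriveM (is_deriveB d2 d3) (is_derive_cst e^-1 u (1 : R)).
have -> : Ramp e c = (fun z => ((z - c) * (z - c + `|z - c|) / 4 -
     (z - (c + e)) * (z - (c + e) + `|z - (c + e)|) / 4) * e^-1).
  by apply/funext => z; rewrite /Ramp !opprD !addrA.
move=> H; apply: (@is_derive_eq _ _ _ _ _ _ _ _ H).
by rewrite /GRing.scale /= /ramp mulr0 add0r mulrC opprD addrA.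
Qed.

Lemma continuous_ramp e c : continuous (ramp e c).
Proof.
move=> u; apply: cvgMl; apply: cvgB.
  apply: (continuous_comp (f := fun z => z - c)); last exact: continuous_pospart.
  by apply: cvgB; [exact: cvg_id|exact: cvg_cst].
apply: (continuous_comp (f := fun z => z - c - e)); last exact: continuous_pospart.
by apply: cvgB; [apply: cvgB; [exact: cvg_id|exact: cvg_cst]|exact: cvg_cst].
Qed.

Lemma pospart_id (y : R) : 0 <= y -> pospart y = y.
Proof. by move=> y0; rewrite /pospart ger0_norm //; lra. Qed.

Lemma pospart_0 (y : R) : y <= 0 -> pospart y = 0.
Proof. by move=> y0; rewrite /pospart ler0_norm // subrr mul0r. Qed.

Lemma ramp0 e c u : 0 < e -> u <= c -> ramp e c u = 0 /\ Ramp e c u = 0.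
Proof.
move=> e0 uc; rewrite /ramp /Ramp !pospart_0 ?subrr ?mul0r; try lra.
by split=> //; rewrite !ler0_norm ?subrr ?mulr0 ?mul0r ?subrr ?mul0r //; lra.
Qed.

Lemma ramp1 e c u : 0 < e -> c + e <= u -> ramp e c u = 1 /\ Ramp e c u = u - c - e / 2.
Proof.
move=> e0 uc; rewrite /ramp /Ramp !pospart_id; try lra.
rewrite !ger0_norm; try lra.
by split; field; rewrite gt_eqF.
Qed.

Lemma ramp_bounds e c u : 0 < e -> 0 <= ramp e c u <= 1.
Proof.
move=> e0; rewrite /ramp /pospart ler_pdivlMr // ler_pdivrMr // mul0r mul1r.
by apply/andP; case: (ger0P (u - c)) => h1; case: (ger0P (u - c - e)) => h2; split; lra.
Qed.

Lemma ramp_le e c c' u : 0 < e -> c <= c' -> ramp e c' u <= ramp e c u.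
Proof.
move=> e0 cc; rewrite /ramp ler_pM2r ?invr_gt0 // /pospart.
case: (ger0P (u - c)) => h1; case: (ger0P (u - c - e)) => h2;
case: (ger0P (u - c')) => h3; case: (ger0P (u - c' - e)) => h4; lra.
Qed.

(** Differences of ramps are trapezoids of areas b - a and 1 - 3 e. The difference [k] of the two
    normalised trapezoids has total integral 0, so its antiderivative [K] vanishes near 0 and near 1
    and [stein_limit] applies. The wide trapezoid is at most 1, which bounds the narrow one. *)
Lemma window_limit (e a b : R) : 0 < e -> e <= a -> a < b -> b <= 1 - 2 * e ->
  forall d, 0 < d -> \forall n \near \oo,
    E n (fun s => (a + e <= Phi (scaled n s) <= b)%R%:R) <= (b - a) / (1 - 3 * e) + d.
Proof.
move=> e0 ea ab be d d0.
have e3 : 0 < 1 - 3 * e by lra.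
have ba : 0 < b - a by lra.
pose trap a b u := ramp e a u - ramp e b u.
pose Trap a b u := Ramp e a u - Ramp e b u.
pose k u := trap a b u / (b - a) - trap e (1 - 2 * e) u / (1 - 3 * e).
pose K u := Trap a b u / (b - a) - Trap e (1 - 2 * e) u / (1 - 3 * e).
have dT c c' u : is_derive u (1 : R) (Trap c c') (trap c c' u).
  exact: is_deriveB (is_derive_Ramp _ _ _) (is_derive_Ramp _ _ _).
have dK u : is_derive u (1 : R) K (k u).
  have h1 := is_deriveM (dT a b u) (is_derive_cst (b - a)^-1 u (1 : R)).
  have h2 := is_deriveM (dT e (1 - 2 * e) u) (is_derive_cst (1 - 3 * e)^-1 u (1 : R)).
  apply: (@is_derive_eq _ _ _ _ _ _ _ _ (is_deriveB h1 h2)).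
  by rewrite /GRing.scale /= !mulr0 !add0r /k; congr (_ - _); rewrite mulrC.
have ck : continuous k.
  have ct c c' : continuous (trap c c').
    by move=> u; apply: cvgB; exact: continuous_ramp.
  by move=> u; apply: cvgB; apply: cvgMl; exact: ct.
have K0 u : u <= e \/ 1 - e <= u -> K u = 0 /\ k u = 0.
  rewrite /K /k /Trap /trap; case=> hu.
    have [-> ->] := @ramp0 e a u e0 (le_trans hu ea).
    have [-> ->] : ramp e b u = 0 /\ Ramp e b u = 0 by apply: ramp0 => //; lra.
    have [-> ->] : ramp e e u = 0 /\ Ramp e e u = 0 by apply: ramp0.
    have [-> ->] : ramp e (1 - 2 * e) u = 0 /\ Ramp e (1 - 2 * e) u = 0 by apply: ramp0 => //; lra.
    by rewrite subrr !mul0r subrr.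
  have [-> ->] : ramp e a u = 1 /\ Ramp e a u = u - a - e / 2 by apply: ramp1 => //; lra.
  have [-> ->] : ramp e b u = 1 /\ Ramp e b u = u - b - e / 2 by apply: ramp1 => //; lra.
  have [-> ->] : ramp e e u = 1 /\ Ramp e e u = u - e - e / 2 by apply: ramp1 => //; lra.
  have [-> ->] : ramp e (1 - 2 * e) u = 1 /\ Ramp e (1 - 2 * e) u = u - (1 - 2 * e) - e / 2.
    by apply: ramp1 => //; lra.
  split; last by rewrite subrr !mul0r subrr.
  by field; rewrite !gt_eqF.
have be1 : 1 - e < 1 by lra.
have := stein_limit e0 be1 dK ck K0 d0; apply: filterS => n hn.
pose W s := Phi (scaled n s).
have E1 : E n (fun s => k (W s)) = E n (fun s => trap a b (W s)) / (b - a) -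
    E n (fun s => trap e (1 - 2 * e) (W s)) / (1 - 3 * e).
  rewrite EsumB; congr (_ - _).
    by rewrite [RHS]mulrC -EsumZ; apply: eq_Esum => s; exact: mulrC.
  by rewrite [RHS]mulrC -EsumZ; apply: eq_Esum => s; exact: mulrC.
have E2 : E n (fun s => trap e (1 - 2 * e) (W s)) <= 1.
  rewrite -[leRHS](Esum_cst x p1 n 1); apply: ler_Esum => // s; rewrite /trap.
  have /andP[_ h1] := ramp_bounds e (W s) e0.
  by have /andP[h2 _] := ramp_bounds (1 - 2 * e) (W s) e0; lra.
have E3 : E n (fun s => (a + e <= W s <= b)%R%:R) <= E n (fun s => trap a b (W s)).
  apply: ler_Esum => // s; rewrite /trap.
  case: (boolP (a + e <= W s <= b)) => [/andP[h1 h2]|_] /=; last by rewrite subr_ge0 ramp_le // ltW.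
  by rewrite (proj1 (ramp1 e0 h1)) (proj1 (ramp0 e0 h2)) subr0.
move: hn; rewrite -/(W _) E1 ler_norml => /andP[_ hn].
apply: (le_trans E3).
set A := E n _ in hn *; set B := E n _ in E2 hn.
have h1 : A <= (b - a) * (B / (1 - 3 * e) + d).
  by rewrite mulrC -ler_pdivrMr //; lra.
have h2 : B / (1 - 3 * e) <= (1 - 3 * e)^-1 by rewrite ler_pdivrMr // mulVf // gt_eqF.
have h3 : (b - a) * (B / (1 - 3 * e)) <= (b - a) / (1 - 3 * e) by rewrite ler_pM2l.
have h4 : (b - a) * d <= d by rewrite -[leRHS]mul1r ler_pM2r //; lra.
by rewrite (le_trans h1) // mulrDr lerD.
Qed.

(** Chebyshev's inequality. It controls the mass near the ends of (0, 1), which the windows miss. *)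
Lemma tail_bound (n : nat) (L : R) : 0 < L -> (0 < n)%N ->
  E n (fun s => (L <= `|scaled n s|)%R%:R) <= L ^- 2.
Proof.
move=> L0 n0; have nV : 0 < n%:R * V :> R by rewrite mulr_gt0 // ltr0n.
apply: (@le_trans _ _ (E n (fun s => (L ^- 2 / (n%:R * V)) * s ^+ 2))).
  apply: ler_Esum => // s.
  have -> : L ^- 2 / (n%:R * V) * s ^+ 2 = (scaled n s) ^+ 2 / L ^+ 2.
    by rewrite exprMn exprVn sqr_sqrtr ?ltW //; field; rewrite !gt_eqF ?ltr0n.
  case: (boolP (L <= `|scaled n s|)) => h /=; last by rewrite divr_ge0 ?sqr_ge0.
  rewrite ler_pdivlMr ?exprn_gt0 // mul1r -[leRHS]real_normK ?num_real //.
  by rewrite lerXn2r // nnegrE ?ltW.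
by rewrite EsumZ (Esum_sqr p1 mean0 varE) divfK // gt_eqF.
Qed.

(** [window_limit] bounds from above only. It is applied below and above Phi y, and the second
    bound, through the complementary event, gives the lower estimate. *)
Theorem central_limit (y d : R) : 0 < d ->
  \forall n \near \oo, `|E n (fun s => (scaled n s <= y)%R%:R) - Phi y| <= d.
Proof.
move=> d0; pose L := 1 + 4 / d.
have d4 : 0 < 4 / d by rewrite divr_gt0.
have L0 : 0 < L by rewrite /L; lra.
have Ld : L ^- 2 <= d / 4.
  rewrite -[d / 4]invrK lef_pV2 ?posrE ?exprn_gt0 ?invr_gt0 ?divr_gt0 // invf_div.
  by rewrite /L expr2; nra.
have /andP[b0 b1] := Phi_gt0_lt1 y; set b := Phi y in b0 b1 *.
have /andP[l0 _] := Phi_gt0_lt1 (- L); have /andP[_ u1] := Phi_gt0_lt1 L.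
(* The first two entries make [frac] hold, the next two make both windows admissible, and the last
   two ensure that a value of Phi below 2 e or above 1 - 2 e forces |w| > L. *)
pose e := Num.min (Num.min (d / 24) (1 / 12)) (Num.min (Num.min (b / 4) ((1 - b) / 4))
   (Num.min (Phi (- L) / 4) ((1 - Phi L) / 4))).
have e0 : 0 < e by rewrite /e !lt_min; apply/andP; split; apply/andP; split; try (apply/andP; split); lra.
have : e <= e by [].
rewrite {2}/e !le_min => /andP[/andP[e1 e2] /andP[/andP[e3 e4] /andP[e5 e6]]].
have frac (c : R) : 0 < c -> c < 1 -> (c - e) / (1 - 3 * e) <= c + d / 4.
  move=> c0 c1; rewrite ler_pdivrMr; last by lra.
  by nra.
have d40 : 0 < d / 4 by rewrite divr_gt0.
have w1 : \forall n \near \oo,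
    E n (fun s => (e + e <= Phi (scaled n s) <= b)%R%:R) <= (b - e) / (1 - 3 * e) + d / 4.
  by apply: window_limit => //; lra.
have w2 : \forall n \near \oo,
    E n (fun s => ((b - e) + e <= Phi (scaled n s) <= 1 - 2 * e)%R%:R) <=
      (1 - 2 * e - (b - e)) / (1 - 3 * e) + d / 4.
  by apply: window_limit => //; lra.
near=> n.
have n0 : (0 < n)%N by near: n; exact: nbhs_infty_gt.
have w1n : E n (fun s => (e + e <= Phi (scaled n s) <= b)%R%:R) <= (b - e) / (1 - 3 * e) + d / 4.
  by near: n; exact: w1.
have w2n : E n (fun s => ((b - e) + e <= Phi (scaled n s) <= 1 - 2 * e)%R%:R) <=
      (1 - 2 * e - (b - e)) / (1 - 3 * e) + d / 4 by near: n; exact: w2.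
have tl := tail_bound L0 n0.
have up : E n (fun s => (scaled n s <= y)%R%:R) <=
  E n (fun s => (L <= `|scaled n s|)%R%:R) + E n (fun s => (e + e <= Phi (scaled n s) <= b)%R%:R).
  rewrite -EsumD; apply: ler_Esum => // s; set w := scaled n s.
  case: (leP w y) => [wy|_] /=; last by rewrite addr_ge0 // ler0n.
  have [hw|hw] := leP (e + e) (Phi w).
    by rewrite (Phi_le wy : Phi w <= b) /= lerDr ler0n.
  have : w < - L by apply: Phi_lt_cancel; lra.
  move=> wL; have -> : L <= `|w| by rewrite ler0_norm; lra.
  by rewrite lerDl ler0n.
have lo : 1 - E n (fun s => (scaled n s <= y)%R%:R) <=
  E n (fun s => (L <= `|scaled n s|)%R%:R) +
  E n (fun s => ((b - e) + e <= Phi (scaled n s) <= 1 - 2 * e)%R%:R).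
  rewrite -[X in X - _](Esum_cst x p1 n 1) -EsumB -EsumD; apply: ler_Esum => // s.
  set w := scaled n s; case: (leP w y) => [_|yw] /=; first by rewrite subrr addr_ge0 // ler0n.
  rewrite subr0 subrK (ltW (Phi_lt yw : b < Phi w)) /=.
  have [hw|hw] := leP (Phi w) (1 - 2 * e); first by rewrite lerDr ler0n.
  have : L < w by apply: Phi_lt_cancel; lra.
  move=> wL; have -> : L <= `|w| by rewrite ger0_norm; lra.
  by rewrite lerDl ler0n.
have f1 := frac _ b0 b1.
have f2 : (1 - 2 * e - (b - e)) / (1 - 3 * e) <= 1 - b + d / 4.
  have -> : 1 - 2 * e - (b - e) = 1 - b - e by lra.
  by apply: frac; lra.
by rewrite ler_norml; apply/andP; split; lra.
Unshelve. all: by end_near. Qed.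

End CentralLimit.

(** * Second-order asymptotics *)

Section SecondOrder.
Variable R : realType.
Local Notation C := R[i].
Local Notation "x %:C" := (real_complex R x) : ring_scope.
Local Notation Re := (@complex.Re R).
Local Notation "T ^^ n" := {ffun 'I_n -> T} (at level 30).

Lemma entropy_spop (T : finType) (l : T -> R) (v : T -> T -> C) : orthonormal v ->
  entropy (spop l v) = - \sum_k l k * logc (l k).
Proof.
move=> ov; rewrite /entropy /oplog opfun_spop // retr_spop_mul; congr (- _).
apply: eq_bigr => k _; congr (_ * _).
by rewrite /qf app_spop_basis // ip_scaler ip_orth // eqxx mulr1.
Qed.

(** * Moments of the Nussbaum-Szkola log-ratio and bounds on the error probabilities *)

Section Marginals.
Variables TA TB : finType.
Local Notation TAB := (TA * TB)%type.

Lemma sum_pair (K : nmodType) (F : TAB -> K) :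
  \sum_x F x = \sum_a \sum_b F (a, b).
Proof. by rewrite pair_bigA; apply: eq_bigr => -[]. Qed.

Lemma qf_ptrB (rho : op R TAB) (ua : TA -> TA -> C) (ub : TB -> TB -> C) al :
  orthonormal ub ->
  qf (ptrB rho) (ua al) = \sum_be qf rho (tens_basis ua ub (al, be)).
Proof.
move=> ob; rewrite /qf -Re_sum; congr (Re _).
transitivity (\sum_(x : TAB) \sum_(y : TAB) conjc (ua al x.1) * rho x y * ua al y.1 *
   \sum_be ub be y.2 * conjc (ub be x.2)).
  rewrite sum_pair /ip /app; apply: eq_bigr => a _; rewrite mulr_sumr.
  transitivity (\sum_b \sum_a' conjc (ua al a) * rho (a, b) (a', b) * ua al a').
    rewrite exchange_big; apply: eq_bigr => a' _ /=.
    by rewrite /ptrB mulr_suml mulr_sumr; apply: eq_bigr => b _; rewrite mulrA.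
  apply: eq_bigr => b _.
  rewrite sum_pair; apply: eq_bigr => a' _.
  rewrite (bigD1 b) //= basis_complete // eqxx mulr1 big1 ?addr0 // => b' /negbTE bb.
  by rewrite basis_complete // bb mulr0.
under eq_bigr do under eq_bigr do rewrite mulr_sumr.
under eq_bigr do rewrite exchange_big.
rewrite exchange_big; apply: eq_bigr => be _ /=.
rewrite /ip; apply: eq_bigr => x _; rewrite /app mulr_sumr; apply: eq_bigr => y _.
by rewrite /tens_basis /= conjcM; ring.
Qed.

Lemma qf_ptrA (rho : op R TAB) (ua : TA -> TA -> C) (ub : TB -> TB -> C) be :
  orthonormal ua ->
  qf (ptrA rho) (ub be) = \sum_al qf rho (tens_basis ua ub (al, be)).
Proof.
move=> oa; rewrite /qf -Re_sum; congr (Re _).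
transitivity (\sum_(x : TAB) \sum_(y : TAB) conjc (ub be x.2) * rho x y * ub be y.2 *
   \sum_al ua al y.1 * conjc (ua al x.1)).
  rewrite sum_pair exchange_big /ip /app; apply: eq_bigr => b _; rewrite mulr_sumr.
  transitivity (\sum_a \sum_b' conjc (ub be b) * rho (a, b) (a, b') * ub be b').
    rewrite exchange_big; apply: eq_bigr => b' _ /=.
    by rewrite /ptrA mulr_suml mulr_sumr; apply: eq_bigr => a _; rewrite mulrA.
  apply: eq_bigr => a _.
  rewrite sum_pair exchange_big; apply: eq_bigr => b' _.
  rewrite /= (bigD1 a) //= basis_complete // eqxx mulr1 big1 ?addr0 // => a' /negbTE aa.
  by rewrite basis_complete // aa mulr0.
under eq_bigr do under eq_bigr do rewrite mulr_sumr.
under eq_bigr do rewrite exchange_big.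
rewrite exchange_big; apply: eq_bigr => al _ /=.
rewrite /ip; apply: eq_bigr => x _; rewrite /app mulr_sumr; apply: eq_bigr => y _.
by rewrite /tens_basis /= conjcM; ring.
Qed.

Lemma logcM (a b : R) : 0 < a -> 0 < b -> logc (a * b) = logc a + logc b.
Proof. by move=> a0 b0; rewrite /logc mulr_gt0 // a0 b0 lnM. Qed.

Lemma qf_spop_basis (T : finType) (l : T -> R) (v : T -> T -> C) k : orthonormal v ->
  qf (spop l v) (v k) = l k.
Proof. by move=> ov; rewrite /qf app_spop_basis // ip_scaler ip_orth // eqxx mulr1. Qed.

Variables (l : TAB -> R) (v : TAB -> TAB -> C).
Variables (a : TA -> R) (ua : TA -> TA -> C) (b : TB -> R) (ub : TB -> TB -> C).
Let rho := spop l v.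
Let u := tens_basis ua ub.
Let m (k : TAB) := a k.1 * b k.2.
Hypothesis ov : orthonormal v.
Hypothesis oa : orthonormal ua.
Hypothesis ob : orthonormal ub.
Hypothesis rA : ptrB rho = spop a ua.
Hypothesis rB : ptrA rho = spop b ub.
Hypothesis l0 : forall k, 0 <= l k.
Hypothesis l1 : \sum_k l k = 1.
Hypothesis a0 : forall k, 0 <= a k.
Hypothesis b0 : forall k, 0 <= b k.

Let ou : orthonormal u. Proof. exact: orthonormal_tens. Qed.

Definition NS_pmf (z : TAB * TAB) : R := l z.1 * nsq (ip (u z.2) (v z.1)).
Definition NS_llr (z : TAB * TAB) : R := logc (l z.1) - logc (m z.2) - mutinf rho.

Lemma NS_pmf_ge0 z : 0 <= NS_pmf z.
Proof. by rewrite mulr_ge0 // nsq_ge0. Qed.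

Lemma NS_pmf_sum1 : \sum_z NS_pmf z = 1.
Proof.
rewrite -(pair_bigA _ (fun i j => l i * nsq (ip (u j) (v i)))) /= -l1.
by apply: eq_bigr => i _; rewrite -mulr_sumr -parseval // nrm_basis // mulr1.
Qed.

Lemma NS_marginal2 j : \sum_i NS_pmf (i, j) = qf rho (u j).
Proof.
rewrite /rho qf_spop; apply: eq_bigr => i _.
by rewrite /NS_pmf -nsq_conj ip_conj.
Qed.

(** Summing out B leaves the diagonal of rho_A in its own eigenbasis. This turns a cross term of the
    mean into the entropy of a marginal. *)
Lemma NS_marginalA al : \sum_be \sum_i NS_pmf (i, (al, be)) = a al.
Proof.
transitivity (qf (ptrB rho) (ua al)); last by rewrite rA qf_spop_basis.
by rewrite (qf_ptrB _ _ _ ob); apply: eq_bigr => be _; exact: NS_marginal2.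
Qed.

Lemma NS_marginalB be : \sum_al \sum_i NS_pmf (i, (al, be)) = b be.
Proof.
transitivity (qf (ptrA rho) (ub be)); last by rewrite rB qf_spop_basis.
by rewrite (qf_ptrA _ _ _ oa); apply: eq_bigr => al _; exact: NS_marginal2.
Qed.

(** A vanishing marginal forces all its nonnegative terms to vanish. The convention log 0 = 0 is
    therefore met only on events of probability zero. *)
Lemma NS_support z : NS_pmf z != 0 -> [/\ 0 < l z.1, 0 < a z.2.1 & 0 < b z.2.2].
Proof.
case: z => i [al be] /= P0; split.
- rewrite lt_def l0 andbT; apply: contraNneq P0 => h.
  by rewrite /NS_pmf /= h mul0r.
- rewrite lt_def a0 andbT; apply: contraNneq P0 => h.
  have /eqP := NS_marginalA al; rewrite h psumr_eq0 => [|be' _]; last first.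
    by apply: sumr_ge0 => i' _; apply: NS_pmf_ge0.
  move=> /allP /(_ be); rewrite mem_index_enum => /(_ isT) /=.
  rewrite psumr_eq0 => [|i' _]; last exact: NS_pmf_ge0.
  by move=> /allP /(_ i); rewrite mem_index_enum => /(_ isT).
- rewrite lt_def b0 andbT; apply: contraNneq P0 => h.
  have /eqP := NS_marginalB be; rewrite h psumr_eq0 => [|al' _]; last first.
    by apply: sumr_ge0 => i' _; apply: NS_pmf_ge0.
  move=> /allP /(_ al); rewrite mem_index_enum => /(_ isT) /=.
  rewrite psumr_eq0 => [|i' _]; last exact: NS_pmf_ge0.
  by move=> /allP /(_ i); rewrite mem_index_enum => /(_ isT).
Qed.

Lemma NS_mean : \sum_z NS_pmf z * NS_llr z = 0.
Proof.
have split3 z : NS_pmf z * NS_llr z = NS_pmf z * logc (l z.1)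
    - NS_pmf z * logc (a z.2.1) - NS_pmf z * logc (b z.2.2) - NS_pmf z * mutinf rho.
  have [->|P0] := eqVneq (NS_pmf z) 0; first by rewrite !mul0r !subr0.
  have [lz az bz] := NS_support P0.
  by rewrite /NS_llr /m logcM //; ring.
under eq_bigr do rewrite split3.
rewrite !sumrB -[X in _ - X]mulr_suml NS_pmf_sum1 mul1r.
have -> : \sum_z NS_pmf z * logc (l z.1) = \sum_i l i * logc (l i).
  rewrite -(pair_bigA _ (fun i j => NS_pmf (i, j) * logc (l i))) /=.
  apply: eq_bigr => i _; rewrite -mulr_suml /NS_pmf /= -mulr_sumr -parseval //.
  by rewrite nrm_basis // mulr1.
have -> : \sum_z NS_pmf z * logc (a z.2.1) = \sum_al a al * logc (a al).
  rewrite -(pair_bigA _ (fun i j => NS_pmf (i, j) * logc (a j.1))) /= exchange_big /=.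
  rewrite -(pair_bigA _ (fun al be => \sum_i NS_pmf (i, (al, be)) * logc (a al))) /=.
  apply: eq_bigr => al _.
  transitivity ((\sum_be \sum_i NS_pmf (i, (al, be))) * logc (a al)); last by rewrite NS_marginalA.
  rewrite mulr_suml; by apply: eq_bigr => be _; rewrite mulr_suml.
have -> : \sum_z NS_pmf z * logc (b z.2.2) = \sum_be b be * logc (b be).
  rewrite -(pair_bigA _ (fun i j => NS_pmf (i, j) * logc (b j.2))) /= exchange_big /=.
  rewrite -(pair_bigA _ (fun al be => \sum_i NS_pmf (i, (al, be)) * logc (b be))) /=.
  rewrite exchange_big; apply: eq_bigr => be _ /=.
  transitivity ((\sum_al \sum_i NS_pmf (i, (al, be))) * logc (b be)); last by rewrite NS_marginalB.
  rewrite mulr_suml; by apply: eq_bigr => al _; rewrite mulr_suml.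
rewrite /mutinf rA rB !entropy_spop //; ring.
Qed.

(** The two logarithms need not commute: in <u_j|K v_i> one acts on v_i to the right and the other
    on u_j to the left, so each is a number. Parseval in the basis u then expands |K v_i|^2. *)
Lemma NS_var : \sum_z NS_pmf z * NS_llr z ^+ 2 = mutinf_var rho.
Proof.
rewrite /mutinf_var; set K := opadd _ _.
have sE : optens (ptrB rho) (ptrA rho) = spop m u by rewrite rA rB optens_spop.
have hK : hermitian K.
  apply: hermitian_add; last exact/hermitian_opp/hermitian_scale/hermitian_one.
  rewrite sE /oplog !opfun_spop //.
  by apply: hermitian_add; [exact: hermitian_spop|exact/hermitian_opp/hermitian_spop].
rewrite [in RHS]/rho retr_spop_mul -(pair_bigA _ (fun i j => NS_pmf (i, j) * NS_llr (i, j) ^+ 2)) /=.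
apply: eq_bigr => i _.
have -> : qf (opmul K K) (v i) = nrm (app K (v i)).
  by rewrite /qf app_mul ip_appC // nrmE.
rewrite (parseval ou) mulr_sumr; apply: eq_bigr => j _.
suff -> : ip (u j) (app K (v i)) = (NS_llr (i, j))%:C * ip (u j) (v i).
  by rewrite nsqM nsq_real /NS_pmf /=; ring.
rewrite /K sE /oplog !opfun_spop // !app_add !app_opp app_scale app_one !ip_addr.
have ipN w z : ip w (\- z) = - ip (T := TAB) w z.
  by rewrite /ip -sumrN; apply: eq_bigr => x _; rewrite mulrN.
rewrite !ipN ip_scaler ip_basis_spop // app_spop_basis // ip_scaler /=.
by rewrite /NS_llr /= !rmorphB /=; ring.
Qed.

(** Pairs of probability zero contribute 0 on both sides; on the others all eigenvalues are positive
    and logarithms turn the product condition into one on the centred sum. *)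
Lemma NS_cdf_Esum (n : nat) (y : R) :
  NS_cdf n l m v u (expR (n%:R * mutinf rho + y)) =
  Esum NS_pmf NS_llr n (fun s => (s <= y)%R%:R).
Proof.
rewrite Esum_ffun /NS_cdf.
pose F (i j : TAB ^^ n) : R := (\prod_k NS_pmf (i k, j k)) *
   ((\sum_k NS_llr (i k, j k)) <= y)%R%:R.
transitivity (\sum_i \sum_j F i j); last first.
  rewrite -(@sum_ffun_pair n _ _ _ _ _ F); apply: eq_bigr => z _; rewrite /F.
  congr (_ * _%:R).
    by apply: eq_bigr => k _; rewrite !ffunE -surjective_pairing.
  congr (nat_of_bool (_ <= _)).
  by apply: eq_bigr => k _; rewrite !ffunE -surjective_pairing.
apply: eq_bigr => i _; rewrite big_mkcond; apply: eq_bigr => j _; rewrite /F.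
have PE : pow_eig l i * nsq (ip (pow_basis u j) (pow_basis v i)) = \prod_k NS_pmf (i k, j k).
  by rewrite ip_pow_basis nsq_prod /pow_eig -big_split.
rewrite PE; have [->|P0] := eqVneq (\prod_k NS_pmf (i k, j k)) 0.
  by rewrite mul0r if_same.
have P0k k : NS_pmf (i k, j k) != 0.
  by apply: contraNneq P0 => h; rewrite (bigD1 k) //= h mul0r.
have lE : pow_eig l i = expR (\sum_k logc (l (i k))).
  rewrite expR_sum; apply: eq_bigr => k _; have [lk _ _] := NS_support (P0k k).
  by rewrite /logc lk lnK.
have mE : pow_eig m j = expR (\sum_k logc (m (j k))).
  rewrite expR_sum; apply: eq_bigr => k _; have [_ ak bk] := NS_support (P0k k).
  have mk : 0 < m (j k) by rewrite /m mulr_gt0.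
  by rewrite /logc mk lnK.
have SE : \sum_k NS_llr (i k, j k) =
    \sum_k logc (l (i k)) - \sum_k logc (m (j k)) - n%:R * mutinf rho.
  rewrite /NS_llr; move: (mutinf rho) => I; rewrite !sumrB sumr_const card_ord.
  by rewrite mulr_natl.
rewrite lE mE -expRD ler_expR SE.
have -> : (\sum_k logc (l (i k)) <= n%:R * mutinf rho + y + \sum_k logc (m (j k))) =
   (\sum_k logc (l (i k)) - \sum_k logc (m (j k)) - n%:R * mutinf rho <= y).
  by rewrite !lerBlDr; congr (_ <= _); ring.
by case: (_ <= _); rewrite ?mulr1 ?mulr0.
Qed.

Let drho : density rho. Proof. exact: density_spop. Qed.

Let sE : optens (ptrB rho) (ptrA rho) = spop m u.
Proof. by rewrite rA rB optens_spop. Qed.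

Let m0 k : 0 <= m k. Proof. by rewrite mulr_ge0. Qed.

Section Bounds.
Variables (n : nat) (r d : R).
Hypothesis d0 : 0 < d.
Let eta := expR (- (d * Num.sqrt n%:R)).
Let mu := expR (- (n%:R * (mutinf rho + r / Num.sqrt n%:R))).
Let F y := Esum NS_pmf NS_llr n (fun s => (s <= y * Num.sqrt n%:R)%R%:R).

Let muE : n%:R * (mutinf rho + r / Num.sqrt n%:R) = n%:R * mutinf rho + r * Num.sqrt n%:R.
Proof.
rewrite mulrDr; congr (_ + _).
have [->|n0] := posnP n; first by rewrite mul0r sqrtr0 mulr0.
have sn : 0 < Num.sqrt n%:R :> R by rewrite sqrtr_gt0 ltr0n.
rewrite -[X in X * (r / _)](@sqr_sqrtr _ n%:R) ?ler0n //.
by field; rewrite gt_eqF.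
Qed.

(** The converse with weight eta and c = eta / mu: the threshold eta^2 / mu shifts r by -2 d, and c
    mu = eta. The constraint is used at the marginals of rho. *)
Lemma type2_lower_bound (M : op R (TAB ^^ n)) : test_op M ->
  (forall (s : op R TA) (t : op R TB), density s -> density t ->
     retr (opmul (tens_n (@optpow R TA n s) (@optpow R TB n t)) M) <= mu) ->
  F (r - 2 * d) - 2 * eta <= retr (opmul (@optpow R TAB n rho) (opcompl M)).
Proof.
move=> tM cM; have eta0 : 0 < eta by apply: expR_gt0.
have mu_gt0 : 0 < mu by apply: expR_gt0.
have c0 : 0 < eta / mu by rewrite divr_gt0.
have := testing_converse (orthonormal_pow ov) (orthonormal_pow ou)
  (pow_eig_ge0 l0) (pow_eig_ge0 m0) tM eta0 c0.
have E : eta * (eta / mu) = expR (n%:R * mutinf rho + (r - 2 * d) * Num.sqrt n%:R).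
  by rewrite /eta /mu -expRN -!expRD opprK muE; congr expR; ring.
rewrite E -/(NS_cdf n l m v u _) NS_cdf_Esum -/(F _).
rewrite -!optpow_spop -sE -tens_n_optpow -/rho => le1.
have le2 : eta / mu * retr (opmul (tens_n (@optpow R TA n (ptrB rho)) (@optpow R TB n (ptrA rho))) M) <= eta.
  apply: (@le_trans _ _ (eta / mu * mu)); last by rewrite divfK // gt_eqF.
  by rewrite ler_pM2l //; apply: cM; [exact: density_ptrB|exact: density_ptrA].
(* This lets the factor 1 + eta be absorbed into a second additive eta. *)
have F1 : F (r - 2 * d) <= 1.
  rewrite -[leRHS](Esum_cst NS_llr NS_pmf_sum1 n 1); apply: ler_Esum; first exact: NS_pmf_ge0.
  by move=> s; rewrite lern1 leq_b1.
set er := retr _ in le1 *.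
have le3 : F (r - 2 * d) <= (1 + eta) * (er + eta).
  by apply: (le_trans le1); rewrite ler_pM2l ?addr_gt0 // lerD2l.
have e1 : 0 < 1 + eta by rewrite addr_gt0.
rewrite -(ler_pM2l e1); nra.
Qed.

(** Take K = t = 1 / eta and c = t^2 / mu: then t^2 / c is exactly mu, and K c = eta^-3 / mu shifts
    r by 3 d. The compression weight is [d] itself. *)
Lemma type2_upper_bound : exists M : op R (TAB ^^ n), [/\ test_op M,
  forall s t, sym_state s -> sym_state t -> retr (opmul (tens_n s t) M) <= mu &
  retr (opmul (@optpow R TAB n rho) (opcompl M)) <=
    (1 + d) * (F (r + 3 * d) + (n.+1 ^ #|{: TAB}|)%:R * eta) +
    (2 + d^-1) * ((n.+1 ^ (#|TA| * #|TA|))%:R * eta + (n.+1 ^ (#|TB| * #|TB|))%:R * eta)].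
Proof.
have eta0 : 0 < eta by apply: expR_gt0.
have mu_gt0 : 0 < mu by apply: expR_gt0.
have t0 : 0 < eta^-1 by rewrite invr_gt0.
have c0 : 0 < eta^-1 ^+ 2 / mu by rewrite divr_gt0 // exprn_gt0.
have [M [tM M1 M2]] := composite_achievability n drho ov erefl ou sE l0 l1 m0 c0 t0 t0 d0.
exists M; split=> //.
  move=> s t ss st; apply: (le_trans (M1 s t ss st)).
  by rewrite le_eqVlt; apply/orP; left; apply/eqP; field; rewrite !gt_eqF.
apply: (le_trans M2); rewrite !invrK.
have -> : eta^-1 * (eta^-1 ^+ 2 / mu) = expR (n%:R * mutinf rho + (r + 3 * d) * Num.sqrt n%:R).
  by rewrite /eta /mu expr2 -!expRN -!expRD !opprK muE; congr expR; ring.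
by rewrite NS_cdf_Esum.
Qed.

(** Tensor powers are permutation-invariant, so a test feasible for [alpha_hat] is feasible for
    [alpha_hat_iid]; this carries each bound over to the other quantity. *)
Lemma alpha_hat_bounds :
  let lo := F (r - 2 * d) - 2 * eta in
  let hi := (1 + d) * (F (r + 3 * d) + (n.+1 ^ #|{: TAB}|)%:R * eta) +
    (2 + d^-1) * ((n.+1 ^ (#|TA| * #|TA|))%:R * eta + (n.+1 ^ (#|TB| * #|TB|))%:R * eta) in
  lo <= alpha_hat n rho mu <= hi /\ lo <= alpha_hat_iid n rho mu <= hi.
Proof.
move=> lo hi; have [M [tM M1 M2]] := type2_upper_bound.
have iid_of_sym (N : op R (TAB ^^ n)) :
    (forall s t, sym_state s -> sym_state t -> retr (opmul (tens_n s t) N) <= mu) ->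
    forall (s : op R TA) (t : op R TB), density s -> density t ->
    retr (opmul (tens_n (@optpow R TA n s) (@optpow R TB n t)) N) <= mu.
  move=> h s t ds dt; apply: h.
    by split; [exact: density_optpow|exact: perm_inv_optpow].
  by split; [exact: density_optpow|exact: perm_inv_optpow].
split; apply/andP; split.
- apply: lb_le_inf; first by exists (retr (opmul (@optpow R TAB n rho) (opcompl M))); exists M.
  move=> _ [N [tN N1 ->]]; apply: type2_lower_bound => //; exact: iid_of_sym.
- apply: le_trans M2; apply: ge_inf; last by exists M.
  exists lo => _ [N [tN N1 ->]]; apply: type2_lower_bound => //; exact: iid_of_sym.
- apply: lb_le_inf.
    exists (retr (opmul (@optpow R TAB n rho) (opcompl M))); exists M; split => //.
    exact: iid_of_sym.
  by move=> _ [N [tN N1 ->]]; exact: type2_lower_bound.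
- apply: le_trans M2; apply: ge_inf; last by exists M; split=> //; exact: iid_of_sym.
  by exists lo => _ [N [tN N1 ->]]; exact: type2_lower_bound.
Qed.

End Bounds.

Hypothesis V0 : mutinf_var rho != 0.

Let V_gt0 : 0 < mutinf_var rho.
Proof.
rewrite lt_def V0 -NS_var; apply: sumr_ge0 => z _.
by rewrite mulr_ge0 ?NS_pmf_ge0 ?sqr_ge0.
Qed.

Lemma NS_clt (y d : R) : 0 < d -> \forall n \near \oo,
  `|Esum NS_pmf NS_llr n (fun s => (s <= y * Num.sqrt n%:R)%R%:R) -
    Phi (y / Num.sqrt (mutinf_var rho))| <= d.
Proof.
move=> d0; near=> n.
have n0 : (0 < n)%N by near: n; exact: nbhs_infty_gt.
have -> : Esum NS_pmf NS_llr n (fun s => (s <= y * Num.sqrt n%:R)%R%:R) =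
  Esum NS_pmf NS_llr n (fun s => (s / Num.sqrt (n%:R * mutinf_var rho) <=
    y / Num.sqrt (mutinf_var rho))%R%:R).
  apply: eq_Esum => s; congr (nat_of_bool _)%:R.
  have sV : 0 < Num.sqrt (mutinf_var rho) by rewrite sqrtr_gt0.
  have sn : 0 < Num.sqrt n%:R :> R by rewrite sqrtr_gt0 ltr0n.
  rewrite sqrtrM // ler_pdivrMr ?mulr_gt0 //; congr (_ <= _).
  by field; rewrite gt_eqF.
near: n; exact: (central_limit NS_pmf_ge0 NS_pmf_sum1 NS_mean NS_var V_gt0).
Unshelve. all: by end_near. Qed.

End Marginals.

(** The exponential exceeds its series term of degree 2 (k + 1); the even degree removes the square
    root and leaves n^(k+1), one power more than needed. *)
Lemma poly_mul_expRN_sqrt (k : nat) (d e : R) : 0 < d -> 0 < e ->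
  \forall n \near \oo, (n.+1 ^ k)%:R * expR (- (d * Num.sqrt n%:R)) <= e.
Proof.
move=> d0 e0; pose q : R := (k.+1).*2`!%:R; have q0 : 0 < q by rewrite ltr0n fact_gt0.
near=> n.
have n0 : (0 < n)%N by near: n; exact: nbhs_infty_gt.
have nR : 0 < n%:R :> R by rewrite ltr0n.
have nb : 2 ^+ k * q / (d ^+ (k.+1).*2 * e) < n%:R by near: n; exact: nbhs_infty_gtr.
have y0 : 0 <= d * Num.sqrt n%:R by rewrite mulr_ge0 // ltW.
have dk : 0 < d ^+ (k.+1).*2 by rewrite exprn_gt0.
have ex : d ^+ (k.+1).*2 * n%:R ^+ k.+1 / q <= expR (d * Num.sqrt n%:R).
  apply: le_trans _ (expR_ge1Dxn (k.*2.+1) y0); rewrite -doubleS -/q exprMn -[Num.sqrt n%:R ^+ _]/(Num.sqrt n%:R ^+ (k.+1).*2).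
  rewrite -[X in Num.sqrt _ ^+ X]mul2n exprM sqr_sqrtr ?(ltW nR) //.
  by rewrite lerDr.
rewrite expRN ler_pdivrMr ?expR_gt0 //.
apply: le_trans (_ : e * (d ^+ (k.+1).*2 * n%:R ^+ k.+1 / q) <= _); last by rewrite ler_pM2l.
apply: (@le_trans _ _ (2 ^+ k * n%:R ^+ k)).
  rewrite natrX -exprMn lerXn2r ?nnegrE ?mulr_ge0 // -natrM ler_nat.
  by rewrite mul2n -addnn -addn1 leq_add2l.
move: nb; rewrite (ltr_pdivrMr _ _ (mulr_gt0 dk e0)) => nb.
have nk : 0 < n%:R ^+ k :> R by rewrite exprn_gt0.
move: nb dk; set D := d ^+ _ => nb dk.
have -> : e * (D * n%:R ^+ k.+1 / q) = n%:R * (D * e) * n%:R ^+ k / q.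
  by rewrite (exprSr n%:R k); field; rewrite gt_eqF.
by rewrite ler_pdivlMr // mulrAC ler_pM2r // ltW.
Unshelve. all: by end_near. Qed.

(** The order of limits matters: [d] is fixed first, by continuity of Phi, and only then n grows,
    making the eta terms small for that [d]. *)
Lemma sandwich_limit (F : nat -> R -> R) (V r : R) (k1 k2 k3 : nat) (al : nat -> R) :
  (forall y d, 0 < d -> \forall n \near \oo, `|F n y - Phi (y / Num.sqrt V)| <= d) ->
  (forall n d, 0 < d -> let eta := expR (- (d * Num.sqrt n%:R)) in
     F n (r - 2 * d) - 2 * eta <= al n <=
     (1 + d) * (F n (r + 3 * d) + (n.+1 ^ k1)%:R * eta) +
     (2 + d^-1) * ((n.+1 ^ k2)%:R * eta + (n.+1 ^ k3)%:R * eta)) ->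
  al @ \oo --> Phi (r / Num.sqrt V).
Proof.
move=> hF hal; apply/cvgrPdist_le => e e0.
have e8 : 0 < e / 8 by rewrite divr_gt0.
pose g1 d := Phi ((r - 2 * d) / Num.sqrt V).
pose g2 d := (1 + d) * Phi ((r + 3 * d) / Num.sqrt V).
have c1 : g1 d @[d --> 0^'+] --> g1 0.
  apply: cvg_at_right_filter.
  apply: (@cvg_comp _ _ _ (fun d => (r - 2 * d) / Num.sqrt V) (@Phi R) _
    (nbhs ((r - 2 * 0) / Num.sqrt V))); last exact: Phi_continuous.
  by apply: cvgMl; apply: cvgB; [exact: cvg_cst|apply: cvgMr; exact: cvg_id].
have c2 : g2 d @[d --> 0^'+] --> g2 0.
  apply: cvg_at_right_filter; apply: cvgM.
    by apply: cvgD; [exact: cvg_cst|exact: cvg_id].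
  apply: (@cvg_comp _ _ _ (fun d => (r + 3 * d) / Num.sqrt V) (@Phi R) _
    (nbhs ((r + 3 * 0) / Num.sqrt V))); last exact: Phi_continuous.
  by apply: cvgMl; apply: cvgD; [exact: cvg_cst|apply: cvgMr; exact: cvg_id].
have g10 : g1 0 = Phi (r / Num.sqrt V) by rewrite /g1 mulr0 subr0.
have g20 : g2 0 = Phi (r / Num.sqrt V) by rewrite /g2 mulr0 !addr0 mul1r.
have [d [d0 hd1 hd2]] : exists d, [/\ 0 < d, `|g1 0 - g1 d| <= e / 8 & `|g2 0 - g2 d| <= e / 8].
  near (0 : R)^'+ => d; exists d; split.
  - by near: d; exact: nbhs_right_gt.
  - by near: d; move/cvgrPdist_le : c1; exact.
  - by near: d; move/cvgrPdist_le : c2; exact.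
have d1 : 0 < 1 + d by rewrite addr_gt0.
have d2 : 0 < 2 + d^-1 by rewrite addr_gt0 // invr_gt0.
have f1 := hF (r - 2 * d) _ e8.
have f2 := hF (r + 3 * d) _ (divr_gt0 e8 d1).
have q0 := poly_mul_expRN_sqrt 0 d0 e8.
have q1 := poly_mul_expRN_sqrt k1 d0 (divr_gt0 e8 d1).
have q2 := poly_mul_expRN_sqrt k2 d0 (divr_gt0 e8 d2).
have q3 := poly_mul_expRN_sqrt k3 d0 (divr_gt0 e8 d2).
near=> n.
have r0 : (n.+1 ^ 0)%:R * expR (- (d * Num.sqrt n%:R)) <= e / 8 by near: n; exact: q0.
have r1 : (n.+1 ^ k1)%:R * expR (- (d * Num.sqrt n%:R)) <= e / 8 / (1 + d) by near: n; exact: q1.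
have r2 : (n.+1 ^ k2)%:R * expR (- (d * Num.sqrt n%:R)) <= e / 8 / (2 + d^-1) by near: n; exact: q2.
have r3 : (n.+1 ^ k3)%:R * expR (- (d * Num.sqrt n%:R)) <= e / 8 / (2 + d^-1) by near: n; exact: q3.
have s1 : `|F n (r - 2 * d) - g1 d| <= e / 8 by near: n; exact: f1.
have s2 : `|F n (r + 3 * d) - Phi ((r + 3 * d) / Num.sqrt V)| <= e / 8 / (1 + d).
  by near: n; exact: f2.
move: s1 s2 hd1 hd2 (hal n d d0); set eta := expR _ in r0 r1 r2 r3 *; rewrite g10 g20 !ler_norml.
move=> /andP[s1 _] /andP[_ s2] /andP[_ h1] /andP[h2 _] /andP[lo hi].
rewrite expn0 mul1r in r0.
have t2 : (1 + d) * (F n (r + 3 * d) + (n.+1 ^ k1)%:R * eta) <= g2 d + e / 4.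
  have -> : g2 d + e / 4 = (1 + d) * (Phi ((r + 3 * d) / Num.sqrt V) + e / 8 / (1 + d) + e / 8 / (1 + d)).
    by rewrite /g2; field; rewrite gt_eqF.
  by rewrite ler_pM2l //; lra.
have t3 : (2 + d^-1) * ((n.+1 ^ k2)%:R * eta + (n.+1 ^ k3)%:R * eta) <= e / 4.
  have -> : e / 4 = (2 + d^-1) * (e / 8 / (2 + d^-1) + e / 8 / (2 + d^-1)).
    by move: d2; set D := 2 + d^-1 => d2; field; rewrite gt_eqF.
  by rewrite ler_pM2l // lerD.
by apply/andP; split; lra.
Unshelve. all: by end_near. Qed.

End SecondOrder.

Theorem mainTheorem13 (R : realType) (TA TB : finType)
  (rho : op R (TA * TB)%type) (r : R) :
  density rho -> mutinf_var rho != 0 ->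
  let Rn := fun n : nat => mutinf rho + r / Num.sqrt n%:R in
  (fun n : nat => alpha_hat n rho (expR (- (n%:R * Rn n))))
     @ \oo --> Phi (r / Num.sqrt (mutinf_var rho)) /\
  (fun n : nat => alpha_hat_iid n rho (expR (- (n%:R * Rn n))))
     @ \oo --> Phi (r / Num.sqrt (mutinf_var rho)).
Proof.
move=> dr V0 Rn.
have [[l v] /= [ov rE l0 l1]] := density_spectral dr.
have [[a ua] /= [oa rA a0 _]] := density_spectral (density_ptrB dr).
have [[b ub] /= [ob rB b0 _]] := density_spectral (density_ptrA dr).
rewrite rE in rA rB V0 *.
have clt := NS_clt ov oa ob rA rB l0 l1 a0 b0 V0.
have bounds n d d0 := @alpha_hat_bounds R TA TB l v a ua b ub ov oa ob rA rB l0 l1 a0 b0 n r d d0.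
split; apply: (sandwich_limit clt) => n d d0; have [h1 h2] := bounds n d d0.
  by rewrite /Rn rE; exact: h1.
by rewrite /Rn rE; exact: h2.
Qed.
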